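(* Let $\Delta\geq 4$ be an integer and let $G$ be an outerplanar graph with maximum degree $\Delta(G)\leq\Delta$. Then $G$ has a conditional incidence $\Delta$-coloring.
   Context: All graphs are simple. An outerplanar graph is a graph that can be embedded in the plane with all vertices on the outer face. For a graph $G$, an incidence is a pair $(v,e)$ with $v$ an endpoint of the edge $e$; $I(G)$ is the set of incidences. For $u\in V(G)$ and a neighbor $v$, $(u,uv)$ is a strong incidence of $u$ and $(v,uv)$ is a weak incidence of $u$; $I_u$, $A_u$ denote the sets of strong, resp. weak, incidences of $u$. Let $[\Delta]=\{1,\dots,\Delta\}$. A conditional incidence $\Delta$-coloring of $G$ is a map $\varphi: I(G)\to[\Delta]$ such that: (a) $(u,uv)$ and $(v,uv)$ receive distinct colors for each edge $uv$; (b) each color appears at most once among $A_u$ for each vertex $u$; (c) each color appears at most once among $I_u$ for each vertex $u$; (d) each color of $[\Delta]$ appears at least once among $A_u\cup I_u$ for each vertex $u$ with $\deg_G(u)\geq\Delta-1$. *)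

(* Defs.v *)
From HB Require Import structures.
From mathcomp Require Import all_boot all_order all_algebra.
From mathcomp Require Import all_classical all_reals all_analysis.

Set Implicit Arguments.
Unset Strict Implicit.
Unset Printing Implicit Defensive.

Import Order.TTheory GRing.Theory Num.Theory.
Import numFieldNormedType.Exports.

Local Open Scope classical_set_scope.
Local Open Scope ring_scope.

Record sgraph := SGraph {
  svertex :> finType;
  adj : rel svertex;
  adj_sym : symmetric adj;
  adj_irr : irreflexive adj }.

Section Graph.
Variable G : sgraph.

Definition edges : {set {set G}} :=
  [set [set p.1; p.2]%SET | p : G * G & adj p.1 p.2]%SET.

Definition degree (u : G) : nat := #|[set v | adj u v]%SET|.

Definition max_degree : nat := (\max_(u : G) degree u)%N.

Definition incidence : finType :=
  {i : G * {set G} | (i.2 \in edges) && (i.1 \in i.2)}.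

Definition strong (u : G) : {set incidence} :=
  [set i | [exists v, adj u v && (val i == (u, [set u; v]%SET))]]%SET.

Definition weak (u : G) : {set incidence} :=
  [set i | [exists v, adj u v && (val i == (v, [set u; v]%SET))]]%SET.

Definition conditional_incidence_coloring (Delta : nat)
    (phi : incidence -> 'I_Delta) : Prop :=
  [/\ forall (u v : G) (i j : incidence), adj u v ->
        val i = (u, [set u; v]%SET) -> val j = (v, [set u; v]%SET) ->
        phi i <> phi j,
      forall (u : G) (c : 'I_Delta),
        (#|[set i in weak u | phi i == c]%SET| <= 1)%N,
      forall (u : G) (c : 'I_Delta),
        (#|[set i in strong u | phi i == c]%SET| <= 1)%N &
      forall u : G, (Delta - 1 <= degree u)%N -> forall c : 'I_Delta,
        exists2 i, i \in (weak u :|: strong u)%SET & phi i = c].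

(* An edge e is drawn as the simple arc arc e, parametrized by [0, 1]; the
   values of arc e outside [0, 1], and of arc off the edge set, are junk. *)
Definition plane_embedding (R : realType) (pos : G -> R * R)
    (arc : {set G} -> R -> R * R) : Prop :=
  [/\ injective pos,
      forall e, e \in edges ->
        {within `[0, 1], continuous (arc e)} /\
        {in `[0, 1] &, injective (arc e)},
      forall e, e \in edges ->
        [set arc e 0; arc e 1] = [set pos u | u in [set u | u \in e]],
      forall e, e \in edges -> forall (w : G) (t : R), t \in `]0, 1[ ->
        arc e t <> pos w &
      forall e f, e \in edges -> f \in edges -> e <> f ->
        forall s t : R, s \in `]0, 1[ -> t \in `]0, 1[ -> arc e s <> arc f t].

Definition drawing (R : realType) (pos : G -> R * R)
    (arc : {set G} -> R -> R * R) : set (R * R) :=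
  range pos `|` \bigcup_(e in [set e | e \in edges]) (arc e @` `[0, 1]).

(* The drawing of a finite graph is compact, so exactly one component of its
   complement is unbounded. *)
Definition outer_face (R : realType) (D : set (R * R)) : set (R * R) :=
  [set p | (~` D) p /\ ~ bounded_set (connected_component (~` D) p)].

(* A vertex is on a face when it is on the boundary of that open set, i.e. in
   its closure, since vertices are not in the complement of the drawing. *)
Definition outerplanar (R : realType) : Prop :=
  exists (pos : G -> R * R) (arc : {set G} -> R -> R * R),
    plane_embedding pos arc /\
    forall v : G, closure (outer_face (drawing pos arc)) (pos v).

End Graph.

(* Main.v *)
Require Import Defs.
From HB Require Import structures.
From mathcomp Require Import all_boot all_order all_algebra.
From mathcomp Require Import zify.

(** The argument passes through a combinatorial shadow of outerplanarity.
Replace the arcs by close polygonal lines and join every vertex v to a far point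
by a polygonal line that stays in the outer face except near v.  Two disjoint
segments are vertically ordered in the same way at both ends of their common
range; summed mod 2 along the polygonal lines, this shows that the vertices
carry a tournament (a not necessarily transitive "order") for which the ends of
two disjoint edges interleave an even number of times.  This excludes K_4 and
K_{2,3}: a lobe that is minimal among the subgraphs attached at a single vertex
has a Hamiltonian cycle with noncrossing chords.  Looking at a shortest chord
that spans at least three edges of this cycle, one finds a vertex of degree 1,
two adjacent vertices of degree 2, a triangle with vertices of degrees 2 and 3,
or two or three consecutive triangles cut off by chords.  Each of these
configurations can be removed, coloured inductively and put back, where
condition (d) leaves the necessary freedom; for the chains of triangles the last
step is a finite search. *)

Set Implicit Arguments.
Unset Strict Implicit.
Unset Printing Implicit Defensive.

Local Open Scope nat_scope.

(** * Even tournaments and reducible configurations *)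

(** The far points play the part of an apex joined to all vertices, so K_4 and K_{2,3} fall in the
    way K_5 and K_{3,3} do in the plane, by a parity count instead of the Jordan curve theorem. The
    line from a vertex avoids the edges that do not contain it, but two such lines may meet in any
    way; hence one bit per pair of vertices survives, and no order. An even tournament passes
    unchanged to every subgraph, so the induction deletes edges without redrawing.

    The obstacle in the colouring is a vertex of degree at least D - 1, where condition (d) ties
    outgoing to incoming colours. A triangle can be removed alone if one end of its chord has degree
    at most D - 2. Degree 3 fails this only for D = 4, and there the chord itself helps. Degree 4
    fails for D = 4 and D = 5, whence the chains of triangles: two for D = 5, three or a closed pair
    for D = 4. *)

(* [t u v] reads "u comes before v"; the second condition then says that
   disjoint edges do not interleave. Transitivity of [t] is not required. *)
Definition even_tournament (V : finType) (e t : rel V) :=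
  (forall u v, u != v -> t u v = ~~ t v u) /\
  (forall a b c d, e a b -> e c d -> a != c -> a != d -> b != c -> b != d ->
    t a c (+) t a d (+) (t b c (+) t b d) = false).

Section Structure.
Variables (V : finType) (e t : rel V).
Hypothesis esym : symmetric e.
Hypothesis eirr : irreflexive e.
Hypothesis ev : even_tournament e t.
Implicit Types (a b c d u v w x y z : V) (B : {set V}) (s p q : seq V).

Definition deg u := #|[set v | e u v]|.

(* The parity of the interleaving of the pairs {a, b} and {c, d}. *)
Definition quad a b c d := t a c (+) t a d (+) (t b c (+) t b d).

(** [quad] is additive when either pair is subdivided, so the parity for two disjoint paths is the
    sum of those for pairs of their edges. The inner statement [edge] fixes one edge and sums along
    the other path. *)
Lemma quad_path a p c q : path e a p -> path e c q ->
  {in a :: p, forall x, x \notin c :: q} -> quad a (last a p) c (last c q) = false.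
Proof.
have edge a' b' c' q' : e a' b' -> path e c' q' -> a' \notin c' :: q' ->
    b' \notin c' :: q' -> quad a' b' c' (last c' q') = false.
  move=> ab; elim: q' c' => [|d q' IH] c' /=; first by rewrite /quad !addbb.
  move=> /andP[cd dq]; rewrite !inE !negb_or.
  move=> /and3P[ac ad aq] /and3P[bc bd bq].
  have := IH d dq; rewrite !inE !negb_or ad aq bd bq => /(_ isT isT).
  have := ev.2 a' b' c' d ab cd ac ad bc bd; rewrite /quad.
  by do 6!case: (t _ _).
elim: p a => [|b p IH] a /=; first by rewrite /quad addbb.
move=> /andP[ab bp] cq dis.
have := IH b bp cq (fun x hx => dis x (mem_behead (s := a :: b :: p) hx)).
have := edge a b c q ab cq (dis a (mem_head _ _)) (dis b _).
rewrite !inE eqxx orbT => /(_ isT); rewrite /quad.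
by do 6!case: (t _ _).
Qed.

(* An odd number of the three pairings of four vertices interleave. *)
Lemma no_crossing a b c d : uniq [:: a; b; c; d] ->
  quad a b c d = false -> quad a c b d = false -> quad a d b c = false -> False.
Proof.
rewrite /= !inE !negb_or andbT => /and3P[/and3P[ab ac ad] /andP[bc bd] cd].
rewrite /quad (ev.1 c b) 1?eq_sym // (ev.1 d b) 1?eq_sym // (ev.1 d c) 1?eq_sym //.
by case: (t a b); case: (t a c); case: (t a d); case: (t b c); case: (t b d); case: (t c d).
Qed.

Definition avoids (q p x y : V) := exists r, [/\ path e q r, last q r = y,
  p \notin q :: r & x \notin q :: r].

(* The hypotheses describe a subdivision of K_{2,3} with branch vertices
   [p] and [q]. *)
Lemma no_K23 (p q x y z : V) : uniq [:: p; x; y; z; q] -> e p x -> e p y -> e p z ->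
  avoids q p y x -> avoids q p z x -> avoids q p x y -> avoids q p z y ->
  avoids q p x z -> avoids q p y z -> False.
Proof.
rewrite /= !inE !negb_or andbT.
move=> /and4P[/and4P[px py pz pq] /and3P[xy xz xq] /andP[yz yq] zq] ex ey ez.
have Q u v : e p u -> avoids q p u v -> quad p u q v = false.
  move=> pu [r [qr <- pr ur]].
  have := @quad_path p [:: u] q r; rewrite /= pu => /(_ isT qr); apply.
  by move=> w; rewrite !inE => /orP[] /eqP ->; [move: pr | move: ur]; rewrite inE.
move=> /(Q y x ey) h1 /(Q z x ez) h2 /(Q x y ex) h3 /(Q z y ez) h4 /(Q x z ex) h5
  /(Q y z ey) h6.
(* In the sum of the six relations every bit involving [p] or [q] occurs an even number of times;
   what remains is [t u v (+) t v u] for the three pairs among [x], [y], [z], which is odd. *)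
move: h1 h2 h3 h4 h5 h6; rewrite /quad.
rewrite (ev.1 y x) 1?eq_sym // (ev.1 z x) 1?eq_sym // (ev.1 z y) 1?eq_sym //.
by case: (t p q); case: (t p x); case: (t p y); case: (t p z); case: (t x q);
  case: (t y q); case: (t z q); case: (t x y); case: (t x z); case: (t y z).
Qed.

(* [B] is attached to the rest of the graph at [c] only. *)
Definition lobe B c := [&& c \in B, B != [set c] & [forall u in B, (u != c) ==>
  (0 < deg u) && [forall w, e u w ==> (w \in B)]]].

Lemma lobe_closed B c u w : lobe B c -> u \in B -> u != c -> e u w -> w \in B.
Proof.
move=> /and3P[_ _ /forallP/(_ u)]; move=> h uB uc uw.
by move: h; rewrite uB uc /= => /andP[_ /forallP/(_ w)]; rewrite uw.
Qed.

Lemma lobe_deg B c u : lobe B c -> u \in B -> u != c -> 0 < deg u.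
Proof.
move=> /and3P[_ _ /forallP/(_ u)]; move=> h uB uc.
by move: h; rewrite uB uc /= => /andP[].
Qed.

(** * Minimal lobes and their Hamiltonian cycles *)

Section MinimalLobe.
Variables (B : {set V}) (c : V).
Hypothesis lobeB : lobe B c.
Hypothesis minB : forall B' c', lobe B' c' -> #|B| <= #|B'|.
Hypothesis deg_ge2 : forall u, 0 < deg u -> 1 < deg u.

Let eB x := [rel u v | [&& e u v, u \in B, u != x, v \in B & v != x]].

Lemma eB_sym x : connect_sym (eB x).
Proof.
by apply: sym_connect_sym => u v /=; rewrite esym; do !case: (_ \in _); do !case: (_ == _).
Qed.

(** Minimality makes [B] 2-connected: if deleting [x] separated [y] from [z], one of their
    components would miss [c], and that component with [x] added would be a smaller lobe, attached
    at [x]. *)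
Lemma connect_lobe x y z : x \in B -> y \in B -> y != x -> z \in B -> z != x ->
  connect (eB x) y z.
Proof.
move=> xB yB yx zB zx; apply: contraT => nyz.
have side y' z' : y' \in B -> y' != x -> z' \in B -> z' != x ->
    ~~ connect (eB x) y' z' -> ~~ connect (eB x) y' c -> False.
  move=> yB' yx' zB' zx' nyz' nyc.
  pose S := [set u in B | (u != x) && connect (eB x) y' u].
  have yS : y' \in S by rewrite inE yB' yx' connect0.
  have cS : c \notin S by rewrite inE (negbTE nyc) !andbF.
  have lS : lobe (x |: S) x.
    apply/and3P; split; first by rewrite setU11.
      apply: contraNneq yx' => E; have : y' \in x |: S by rewrite inE yS orbT.
      by rewrite E inE.
    apply/forallP => u; apply/implyP; rewrite inE in_set1 => /orP[->//|uS].
    apply/implyP => ux; have uc : u != c by apply: contraNneq cS => <-.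
    move: (uS); rewrite inE => /and3P[uB _ yu].
    rewrite (lobe_deg lobeB uB uc) /=; apply/forallP => w; apply/implyP => uw.
    have wB := lobe_closed lobeB uB uc uw.
    rewrite !inE wB /=; case: eqVneq => //= wx; apply: connect_trans yu _.
    by apply: connect1; rewrite /= uw uB ux wB wx.
  have := minB lS; apply/negP; rewrite -ltnNge.
  apply: proper_card; apply/properP; split.
    by apply/subsetP => u; rewrite !inE => /orP[/eqP->//|/and3P[]].
  by exists z' => //; rewrite !inE negb_or zB' zx' /=.
case: (boolP (connect (eB x) y c)) => [yc|nyc]; last by case: (side y z).
case: (side z y) => //; first by rewrite eB_sym.
by apply: contra nyz => zc; apply: connect_trans yc _; rewrite eB_sym.
Qed.

Lemma path_lobe x y z : x \in B -> y \in B -> y != x -> z \in B -> z != x ->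
  exists p, [/\ path e y p, last y p = z, uniq (y :: p), {subset y :: p <= B} &
    x \notin y :: p].
Proof.
move=> xB yB yx zB zx; have /connectP[p0 p0p ->] := connect_lobe xB yB yx zB zx.
case/shortenP: p0p => p pp up _; exists p.
have [h1 h2] : path e y p /\ all (fun u => (u \in B) && (u != x)) p.
  elim: p y pp {up yB yx} => [|u p IH] y //= /andP[/and5P[-> _ _ -> ->] /IH[-> ->]] //.
have ally : all (fun u => (u \in B) && (u != x)) (y :: p) by rewrite /= yB yx.
split=> // [u /(allP ally)/andP[]//|].
by apply/negP => /(allP ally); rewrite eqxx andbF.
Qed.

Definition cyc s := [&& uniq s, cycle e s, 2 < size s & all (fun u => u \in B) s].

(** A vertex [u] other than [c] has two neighbours, both in [B]; a path joining them without [u]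
    closes up through [u]. *)
Lemma cyc_exists : exists s, cyc s.
Proof.
case/and3P: (lobeB) => cB Bc _.
have [u uB uc] : exists2 u, u \in B & u != c.
  have /properP[_ [u uB uc]] : [set c] \proper B.
    by rewrite properEneq eq_sym Bc sub1set.
  by exists u => //; rewrite inE in uc.
have : 1 < #|[set v | e u v]| by apply: deg_ge2; exact: lobe_deg lobeB uB uc.
move=> /card_gt1P[y [z []]]; rewrite !inE => uy uz yz.
have yB := lobe_closed lobeB uB uc uy; have zB := lobe_closed lobeB uB uc uz.
have yu : y != u by apply: contraTneq uy => ->; rewrite eirr.
have zu : z != u by apply: contraTneq uz => ->; rewrite eirr.
have [p [yp lp up sp xp]] := path_lobe uB yB yu zB zu.
exists (u :: y :: p); apply/and4P; split.
- by rewrite cons_uniq xp.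
- by rewrite /= rcons_path uy yp lp esym.
- by case: p lp {yp up sp xp} => // /= yz'; rewrite yz' eqxx in yz.
- by apply/allP => v; rewrite inE => /orP[/eqP->//|/sp].
Qed.

Lemma cyc_rot n s : cyc (rot n s) = cyc s.
Proof.
rewrite /cyc rot_uniq rot_cycle size_rot; congr [&& _, _, _ & _].
by apply: eq_all_r => u; rewrite mem_rot.
Qed.

Lemma cyc_rev s : cyc (rev s) = cyc s.
Proof.
rewrite /cyc rev_uniq rev_cycle size_rev all_rev; congr [&& _, _, _ & _].
by apply: eq_cycle => u v /=; rewrite esym.
Qed.

Lemma path_rev a p : path e a p -> exists r,
  [/\ path e (last a p) r, last (last a p) r = a & last a p :: r =i a :: p].
Proof.
move=> ap; exists (rev (belast a p)); split.
- by rewrite rev_path; rewrite (eq_path (e' := e)) // => u v /=; rewrite esym.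
- by case: p {ap} => //= b p; rewrite rev_cons last_rcons.
- by move=> u; rewrite [in RHS]lastI mem_rcons !inE mem_rev.
Qed.

Lemma first_exit (A : pred V) a p : path e a p -> ~~ A a -> A (last a p) ->
  exists p1 b p2, [/\ p = p1 ++ b :: p2, A b, path e a p1, e (last a p1) b &
    all (predC A) (a :: p1)].
Proof.
elim: p a => [|b p IH] a /=; first by move=> _ /negP.
move=> /andP[ab bp] nAa; have [Ab _|nAb /(IH b bp nAb)] := boolP (A b).
  by exists [::], b, p; rewrite /= ab nAa.
case=> p1 [b' [p2 [-> Ab' bp1 eb' al]]]; exists (b :: p1), b', p2.
by rewrite /= ab nAa; move: al => /=.
Qed.

(** Take a longest cycle. An ear whose ends are consecutive on it would lengthen it; otherwise the
    ear and the two arcs of the cycle between its ends form a subdivision of K_{2,3}. *)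
Lemma hamiltonian : exists2 s, cyc s & s =i B.
Proof.
pose P n := [exists s : n.-tuple V, cyc s].
have exP : exists n, P n.
  by have [s cs] := cyc_exists; exists (size s); apply/existsP; exists (in_tuple s).
have ubP n : P n -> n <= #|V|.
  move=> /existsP[s /and4P[us _ _ _]].
  by rewrite -(size_tuple s) -(card_uniqP us) max_card.
case: (ex_maxnP exP ubP) => n /existsP[s cs] maxP.
have maxs s' : cyc s' -> size s' <= size s.
  by move=> cs'; rewrite size_tuple; apply: maxP; apply/existsP; exists (in_tuple s').
exists s => //; case/and4P: (cs) => us _ ss /allP sB.
move=> y; apply/idP/idP => [/sB//|yB]; apply: contraT => ys.
(* Otherwise some ear with interior [y' :: p1] joins [p] to [q] outside [s]. *)
have other (p : V) : exists2 q, q \in (s : seq V) & q != p.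
  case: (tval s) us ss => [|a [|b r]] //=; rewrite inE negb_or => /andP[/andP[ab _] _] _.
  have [<-|] := eqVneq a p; last by exists a; rewrite ?inE ?eqxx.
  by exists b; rewrite ?inE ?eqxx ?orbT // eq_sym.
have [x0 x0s _] := other y; have [p0 p0s p0x0] := other x0.
have yx0 : y != x0 by apply: contraNneq ys => ->.
have [r [yr lr _ rB _]] := path_lobe (sB _ x0s) yB yx0 (sB _ p0s) p0x0.
have := first_exit (A := mem s) yr ys; rewrite lr => /(_ p0s).
case=> r1 [p [r2 [rE ps yr1 ep al]]]; have {}ps : p \in s by [].
set y' := last y r1 in ep.
have y's : y' \notin s by have := allP al _ (mem_last y r1).
have y'B : y' \in B by apply: rB; rewrite rE -cat_cons mem_cat mem_last.
have y'p : y' != p by apply: contraNneq y's => ->.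
(* [y'] is adjacent to [p]; a second path from [y'], now avoiding [p], first meets the cycle at some
   [q] different from [p] and completes the ear. *)
have [q0 q0s q0p] := other p.
have [r' [yr' lr' ur' rB' pr']] := path_lobe (sB _ ps) y'B y'p (sB _ q0s) q0p.
have := first_exit (A := mem s) yr' y's; rewrite lr' => /(_ q0s).
case=> p1 [q [r2' [rE' qs yp1 eq al']]]; have {}qs : q \in s by [].
have qp : q != p by apply: contraNneq pr' => <-; rewrite rE' -cat_cons mem_cat mem_head orbT.
have p1B : {subset y' :: p1 <= B}.
  by move=> u hu; apply: rB'; rewrite rE' -cat_cons mem_cat hu.
have up1 : uniq (y' :: p1) by move: ur'; rewrite rE' -cat_cons cat_uniq => /andP[].
have p1s u : u \in y' :: p1 -> u \notin s by move=> hu; have := allP al' _ hu.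
(* If [q] follows [p] on the cycle, the ear can replace the edge between them. *)
have next (s2 : seq V) : cyc (p :: q :: s2) -> (p :: q :: s2) =i s ->
    size (p :: q :: s2) = size s -> False.
  move=> /and4P[us' cs' ss' sB'] eqs eqsz.
  have /maxs : cyc (p :: (y' :: p1) ++ q :: s2).
    apply/and4P; split.
    - rewrite cons_uniq mem_cat negb_or cat_uniq up1.
      move: us'; rewrite cons_uniq => /andP[-> ->]; rewrite !andbT andTb.
      apply/andP; split; first by apply/negP => /p1s; rewrite ps.
      apply/hasPn => u hu; apply/negP => /p1s; rewrite -eqs inE hu orbT //.
    - move: cs'; rewrite /= !rcons_cat !rcons_path cat_path /= rcons_path.
      by rewrite (esym p y') ep yp1 eq => /and3P[_ -> ->].
    - by rewrite /= size_cat /= !addnS.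
    - rewrite /= all_cat; move: sB' => /= /and3P[-> -> ->] /=.
      by rewrite andbT y'B; apply/allP => u hu; apply: p1B; rewrite inE hu orbT.
  by rewrite -eqsz /= size_cat /= !ltnS addnS ltnNge leq_addl.
have [i s' sE] := rot_to ps.
have crs : cyc (p :: s') by rewrite -sE cyc_rot.
have sE' : p :: s' =i s by move=> u; rewrite -sE mem_rot.
have szE : size (p :: s') = size s by rewrite -sE size_rot.
have qs' : q \in s' by move: qs; rewrite -sE' inE (negbTE qp).
case/splitPr: qs' crs sE' szE {sE} => s1 s2 crs sE' szE.
case: s1 crs sE' szE => [|x1 s1] crs sE' szE; first by case: (next s2).
case/lastP: s2 crs sE' szE => [|s2 x2] crs sE' szE.
  (* Here [q] precedes [p]; reversing the cycle reduces this to [next]. *)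
  have E : rotr 1 (rev (p :: (x1 :: s1) ++ [:: q])) = p :: q :: rev (x1 :: s1).
    by rewrite rev_cons rotr1_rcons rev_cat.
  case: (next (rev (x1 :: s1))); rewrite -E.
  - by rewrite /rotr cyc_rot cyc_rev.
  - by move=> u; rewrite mem_rotr mem_rev sE'.
  - by rewrite size_rotr size_rev.
case/and4P: crs => us' cs' _ _.
have : path e p ((x1 :: s1) ++ q :: rcons s2 x2).
  by move: cs'; rewrite /= rcons_path => /and3P[-> ->].
have ex2p : e x2 p.
  by move: cs'; rewrite /= rcons_path last_cat /= last_rcons => /and3P[].
rewrite cat_path /= => /and3P[/andP[epx1 x1s1] es1q qs2].
have x1q_path : path e x1 (rcons s1 q) by rewrite rcons_path x1s1.
have [rv1 [qrv1 lrv1 mrv1]] := path_rev x1q_path.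
rewrite last_rcons in qrv1 lrv1 mrv1.
have y'q_path : path e y' (rcons p1 q) by rewrite rcons_path yp1.
have [rv3 [qrv3 lrv3 mrv3]] := path_rev y'q_path.
rewrite last_rcons in qrv3 lrv3 mrv3.
have y's' u : u \in y' :: p1 -> u \notin p :: (x1 :: s1) ++ q :: rcons s2 x2.
  by move=> hu; rewrite sE'; apply: p1s.
move: (us'); rewrite cons_uniq cat_uniq => /and4P[pn us1 /hasPn dis us2].
have {}dis u : u \in q :: rcons s2 x2 -> u \notin x1 :: s1 by exact: dis.
have x2in : x2 \in q :: rcons s2 x2 by rewrite inE mem_rcons mem_head orbT.
have qin : q \in q :: rcons s2 x2 by rewrite mem_head.
have x2q : x2 != q.
  by move: us2; rewrite cons_uniq mem_rcons inE negb_or eq_sym => /andP[/andP[]].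
have not1 u : u \notin x1 :: s1 -> u != q -> u \notin q :: rv1.
  by move=> u1 uq; rewrite mrv1 -rcons_cons mem_rcons inE negb_or uq.
have not3 u : u \notin y' :: p1 -> u != q -> u \notin q :: rv3.
  by move=> u1 uq; rewrite mrv3 -rcons_cons mem_rcons inE negb_or uq.
have mem3 u : u \in p :: (x1 :: s1) ++ q :: rcons s2 x2 -> u \notin y' :: p1.
  by apply: contraL => /y's'.
have px1 : p \notin x1 :: s1 by move: pn; rewrite mem_cat negb_or => /andP[].
have p2 : p \notin q :: rcons s2 x2 by move: pn; rewrite mem_cat negb_or => /andP[].
have x1q : x1 != q by apply: contraTneq (dis q qin) => <-; rewrite mem_head.
have x1x2 : x1 != x2 by apply: contraTneq (dis x2 x2in) => <-; rewrite mem_head.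
have x1n2 : x1 \notin q :: rcons s2 x2.
  by apply/negP => /dis; rewrite mem_head.
have y'n := y's' y' (mem_head _ _).
have [y'p' y'1 y'2] : [/\ y' != p, y' \notin x1 :: s1 & y' \notin q :: rcons s2 x2].
  split; first by [].
    by apply: contra y'n => h; rewrite in_cons mem_cat h orbT.
  by apply: contra y'n => h; rewrite in_cons mem_cat h !orbT.
have y'q : y' != q by apply: contraNneq y'2 => ->.
have pq : p != q by rewrite eq_sym.
have p3 : p \notin y' :: p1 by apply: mem3; rewrite mem_head.
have x13 : x1 \notin y' :: p1 by apply: mem3; rewrite !inE eqxx orbT.
have x23 : x2 \notin y' :: p1 by apply: mem3; rewrite in_cons mem_cat x2in !orbT.
(* The two cycle neighbours of [p] and the ear vertex [y'] are each joined to [q] by a branch of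
   their own. *)
exfalso; apply: (@no_K23 p q x1 x2 y').
- have [h1 h2] : p != x1 /\ p != x2.
    by split; [apply: contraNneq px1 => -> | apply: contraNneq p2 => ->]; rewrite ?mem_head.
  have [h3 h4] : x1 != y' /\ x2 != y'.
    by split; [apply: contraNneq x13 => -> | apply: contraNneq x23 => ->]; rewrite mem_head.
  by rewrite /= !inE !negb_or h1 h2 h3 h4 x1x2 x1q x2q y'q pq eq_sym y'p'.
- by [].
- by rewrite esym.
- by rewrite esym.
- by exists rv1; split=> //; apply: not1 => //; exact: dis.
- by exists rv1; split=> //; apply: not1.
- by exists (rcons s2 x2); rewrite last_rcons; split.
- by exists (rcons s2 x2); rewrite last_rcons; split.
- by exists rv3; split=> //; apply: not3.
- by exists rv3; split=> //; apply: not3.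
Qed.
End MinimalLobe.

(* Paths [u s w t x], resp. [u s w t x r y], of an outer cycle whose chords
   [u w] and [w x], resp. [u w], [w x] and [x y], cut off triangles. *)
Definition two_ears (u s w t x : V) := [&& uniq [:: u; s; w; t; x],
  [&& e u s, e s w, e u w, e w t, e t x & e w x] &
  [&& deg s == 2, deg t == 2 & deg w == 4]].

Definition third_ear (u s w t x r y : V) := [&& uniq [:: u; s; w; t; x; r; y],
  [&& e x r, e r y & e x y] & (deg r == 2) && (deg x == 4)].

Definition reducible : Prop :=
  [\/ exists x y, [/\ e x y, deg x = 2 & deg y = 2],
      exists u v w, [/\ e u v, e v w, e u w, deg v = 2 & deg w = 3] |
      exists (u s w t x : V), two_ears u s w t x /\
        (e u x \/ exists r y, third_ear u s w t x r y)].

(** * Reducible configurations under a shortest long chord *)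

Section OuterCycle.
Variables (n : nat) (v : nat -> V).
Hypothesis n_gt2 : 2 < n.
Hypothesis v_inj : forall i j, i < n -> j < n -> v i = v j -> i = j.
Hypothesis v_step : forall i, i.+1 < n -> e (v i) (v i.+1).
Hypothesis v_close : e (v 0) (v n.-1).
Hypothesis v_nbr : forall i w, 0 < i < n -> e (v i) w -> exists2 j, j < n & w = v j.
Hypothesis v_cross : forall i j k l, i < j -> j < k -> k < l -> l < n ->
  e (v i) (v k) -> e (v j) (v l) -> False.

Lemma deg_nbrs k js : 0 < k < n -> uniq js -> all (fun j => j < n) js ->
  (forall j, j < n -> e (v k) (v j) -> j \in js) -> all (fun j => e (v k) (v j)) js ->
  deg (v k) = size js.
Proof.
move=> kn ujs jsn nbr /allP ejs.
have -> : deg (v k) = #|[set w in map v js]|.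
  apply: eq_card => w; rewrite !inE; apply/idP/mapP => [kw|[j jjs ->]]; last exact: ejs.
  have [j jn wj] := v_nbr kn kw; exists j => //; apply: nbr => //; by rewrite -wj.
rewrite cardsE; have /card_uniqP -> : uniq (map v js); last by rewrite size_map.
rewrite map_inj_in_uniq // => i j /(allP jsn) hi /(allP jsn) hj; exact: v_inj.
Qed.

(** For [n > 3] the closing edge spans at least three steps, so a shortest such chord from [v i] to
    [v j] exists. For a vertex strictly between, noncrossing keeps its neighbours within the range
    from [i] to [j], and minimality keeps them within two steps: chords inside merely cut off
    triangles. The vertex [v 0] is where the lobe is attached and may have neighbours elsewhere; it
    is never strictly between. *)
Lemma outer_cycle_reducible : reducible.
Proof.
have vs i j : i.+1 = j -> j < n -> e (v i) (v j) by move=> <-; exact: v_step.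
have vs' i j : i.+1 = j -> j < n -> e (v j) (v i) by move=> *; rewrite esym; exact: vs.
have va i j : (i.+1 == j) || (j.+1 == i) -> i < n -> j < n -> e (v i) (v j).
  by case/orP => /eqP h *; [exact: vs | exact: vs'].
have [n3|n4] := leqP n 3.
  have {n3}nE : n = 3 by lia.
  have irr1 k : e (v k) (v k) = false by exact: eirr.
  apply: Or31; exists (v 1), (v 2); split; first by apply: vs; lia.
    apply: (@deg_nbrs 1 [:: 0; 2]) => //; rewrite ?nE //=.
      by case=> [|[|[|j]]] // _; rewrite irr1.
    by rewrite !va //; lia.
  apply: (@deg_nbrs 2 [:: 0; 1]) => //; rewrite ?nE //=.
    by case=> [|[|[|j]]] // _; rewrite irr1.
  by rewrite esym; move: v_close; rewrite nE /= => ->; rewrite va //; lia.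
pose P (d : nat) := [exists i : 'I_n, exists j : 'I_n,
  (2 < d) && (j == i + d :> nat) && e (v i) (v j)].
have exP : exists d : nat, P d.
  have h0 : 0 < n by lia.
  have h1 : n.-1 < n by lia.
  exists n.-1; apply/existsP; exists (Ordinal h0); apply/existsP; exists (Ordinal h1) => /=.
  by rewrite v_close; apply/andP; split=> //; lia.
have [d /existsP[i /existsP[j /andP[/andP[d2 /eqP jE] eij]]] mind] := ex_minnP exP.
have jn := ltn_ord j.
move: (nat_of_ord i) (nat_of_ord j) jE eij jn => {}i {}j jE eij jn.
have nb k m : i < k -> k < j -> m < n -> e (v k) (v m) ->
    [&& i <= m, m <= j, m <= k.+2, k <= m.+2 & m != k].
  move=> ik kj mn km.
  have mk : m != k by apply: contraTneq km => ->; rewrite eirr.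
  have im : i <= m.
    rewrite leqNgt; apply/negP => mi; apply: (@v_cross m i k j) => //; by rewrite esym.
  have mj : m <= j by rewrite leqNgt; apply/negP => jm; apply: (@v_cross i k j m).
  have short (a b : nat) : i <= a -> b <= j -> a < b -> b - a < d -> e (v a) (v b) ->
      b <= a.+2.
    move=> ia bj ab bad eab; rewrite leqNgt; apply/negP => h.
    have an : a < n by lia.
    have bn : b < n by lia.
    have : P (b - a).
      apply/existsP; exists (Ordinal an); apply/existsP; exists (Ordinal bn) => /=.
      by rewrite eab andbT; lia.
    by move=> /mind; lia.
  have h1 : k < m -> m <= k.+2 by move=> km'; apply: short => //; lia.
  have h2 : m < k -> k <= m.+2 by move=> km'; apply: short; rewrite 1?esym //; lia.
  by lia.
(* A further neighbour of [v k.+1] would have index [k - 1] or [k + 3] and cross the chord from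
   [v k] to [v k.+2]. *)
have ear k : i <= k -> k.+2 <= j -> e (v k) (v k.+2) -> deg (v k.+1) = 2.
  move=> ik kj ek; apply: (@deg_nbrs k.+1 [:: k; k.+2]); rewrite /= ?inE; try lia.
    move=> m mn em; have h := nb k.+1 m ltac:(lia) ltac:(lia) mn em; rewrite !inE.
    have [|m1] := eqVneq m k.-1.
      move=> mE; case: (ltnP 0 k) => k0; last by lia.
      by case: (@v_cross m k k.+1 k.+2) => //; try lia; rewrite esym.
    have [|m2] := eqVneq m k.+3.
      move=> mE; case: (ltnP j k.+3) => k3; first by lia.
      by case: (@v_cross k k.+1 k.+2 m) => //; try lia.
    by lia.
  by rewrite !va //; lia.
have degE k js : i < k -> k < j -> uniq js -> all (fun m => m < n) js ->
    (forall m, m < n -> e (v k) (v m) -> [&& i <= m, m <= j, m <= k.+2, k <= m.+2 & m != k] ->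
       m \in js) ->
    all (fun m => e (v k) (v m)) js -> deg (v k) = size js.
  move=> ik kj u1 a1 h a2; apply: deg_nbrs => //; first by lia.
  by move=> m mn em; apply: h => //; apply: nb.
(* If a triangle starts at [i], triangles are read off upwards; as soon as the next chord is
   missing, the last triangle ends in a vertex of degree 3. *)
have [c1|c1] := boolP (e (v i) (v i.+2)).
  have d1 : deg (v i.+1) = 2 by apply: ear => //; lia.
  have [c2|c2] := boolP ((i.+4 <= j) && e (v i.+2) (v i.+4)); last first.
    apply: Or32; exists (v i), (v i.+1), (v i.+2).
    split=> //; try by apply: vs; lia.
    apply: (@degE _ [:: i; i.+1; i.+3]); rewrite /= ?inE; try lia.
      move=> m mn em hm; rewrite !inE; case: (eqVneq m i.+4) => [mE|]; last by lia.
      by move: c2 hm; rewrite -mE em andbT; lia.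
    by rewrite esym c1 !va //; lia.
  case/andP: c2 => j4 c2.
  have d3 : deg (v i.+3) = 2 by apply: ear => //; lia.
  have d2' : deg (v i.+2) = 4.
    apply: (@degE _ [:: i; i.+1; i.+3; i.+4]); rewrite /= ?inE; try lia.
      by move=> m mn em hm; rewrite !inE; lia.
    by rewrite c2 esym c1 !va //; lia.
  have un (l : seq nat) : uniq l -> all (fun m => m < n) l -> uniq (map v l).
    move=> ul /allP ln; rewrite map_inj_in_uniq // => a b /ln ha /ln hb; exact: v_inj.
  (* Either two triangles fill the range and the chord from [v i] to [v j] closes the chain, or
     [v i.+4] lies inside and its degree is determined too. *)
  have [jE4|j4'] := eqVneq j i.+4.
    apply: Or33; exists (v i), (v i.+1), (v i.+2), (v i.+3), (v i.+4); split.
      apply/and3P; split; [apply: (un [:: i; i.+1; i.+2; i.+3; i.+4]) | |].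
      - by rewrite /= !inE; lia.
      - by rewrite /=; lia.
      - by rewrite c1 c2 !va //; lia.
      - by rewrite d1 d3 d2'.
    by left; rewrite -jE4.
  have [c3|c3] := boolP ((i.+4.+2 <= j) && e (v i.+4) (v i.+4.+2)); last first.
    apply: Or32; exists (v i.+2), (v i.+3), (v i.+4).
    split=> //; try by apply: vs; lia.
    apply: (@degE _ [:: i.+2; i.+3; i.+4.+1]); rewrite /= ?inE; try lia.
      move=> m mn em hm; rewrite !inE; case: (eqVneq m i.+4.+2) => [mE|]; last by lia.
      by move: c3 hm; rewrite -mE em andbT; lia.
    by rewrite esym c2 !va //; lia.
  case/andP: c3 => j6 c3.
  have d5 : deg (v i.+4.+1) = 2 by apply: ear => //; lia.
  have d4 : deg (v i.+4) = 4.
    apply: (@degE _ [:: i.+2; i.+3; i.+4.+1; i.+4.+2]); rewrite /= ?inE; try lia.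
      by move=> m mn em hm; rewrite !inE; lia.
    by rewrite c3 esym c2 !va //; lia.
  apply: Or33; exists (v i), (v i.+1), (v i.+2), (v i.+3), (v i.+4); split.
    apply/and3P; split; [apply: (un [:: i; i.+1; i.+2; i.+3; i.+4]) | |].
    - by rewrite /= !inE; lia.
    - by rewrite /=; lia.
    - by rewrite c1 c2 !va //; lia.
    - by rewrite d1 d3 d2'.
  right; exists (v i.+4.+1), (v i.+4.+2); apply/and3P; split.
  - apply: (un [:: i; i.+1; i.+2; i.+3; i.+4; i.+4.+1; i.+4.+2]).
      by rewrite /= !inE; lia.
    by rewrite /=; lia.
  - by rewrite c3 !va //; lia.
  - by rewrite d5 d4.
(* No triangle starts at [i]. If one starts at [i.+1] or [i.+2], its first vertex has degree 3;
   otherwise these two vertices have degree 2. *)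
have [c4|c4] := boolP (e (v i.+1) (v i.+3)).
  apply: Or32; exists (v i.+3), (v i.+2), (v i.+1).
  split; try by apply: vs'; lia.
  - by rewrite esym.
  - by apply: ear => //; lia.
  apply: (@degE _ [:: i; i.+2; i.+3]); rewrite /= ?inE; try lia.
    by move=> m mn em hm; rewrite !inE; lia.
  by rewrite c4 !va //; lia.
have d1 : deg (v i.+1) = 2.
  apply: (@degE _ [:: i; i.+2]); rewrite /= ?inE; try lia.
    move=> m mn em hm; rewrite !inE; case: (eqVneq m i.+3) => [mE|]; last by lia.
    by rewrite -mE em in c4.
  by rewrite !va //; lia.
have noi m : e (v i.+2) (v m) -> m != i.
  by apply: contraTneq => ->; rewrite esym.
have [c5|c5] := boolP ((i.+4 <= j) && e (v i.+2) (v i.+4)).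
  case/andP: c5 => j4 c5.
  apply: Or32; exists (v i.+4), (v i.+3), (v i.+2).
  split; try by apply: vs'; lia.
  - by rewrite esym.
  - by apply: ear => //; lia.
  apply: (@degE _ [:: i.+1; i.+3; i.+4]); rewrite /= ?inE; try lia.
    by move=> m mn em hm; have := noi m em; rewrite !inE; lia.
  by rewrite c5 !va //; lia.
apply: Or31; exists (v i.+1), (v i.+2); split=> //; first by apply: vs; lia.
apply: (@degE _ [:: i.+1; i.+3]); rewrite /= ?inE; try lia.
  move=> m mn em hm; have := noi m em; rewrite !inE.
  case: (eqVneq m i.+4) => [mE|]; last by lia.
  by move: c5 hm; rewrite -mE em andbT; lia.
by rewrite !va //; lia.
Qed.

End OuterCycle.

(** Crossing chords give a subdivision of K_4: of the three pairings of the four ends, two are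
    joined by disjoint arcs of the cycle and one by the chords, against [no_crossing]. *)
Lemma cycle_no_crossing (n : nat) (f : nat -> V) (i j k l : nat) :
  (forall a b : nat, a < n -> b < n -> f a = f b -> a = b) ->
  (forall b : nat, b.+1 < n -> e (f b) (f b.+1)) -> e (f n.-1) (f 0) ->
  i < j -> j < k -> k < l -> l < n -> e (f i) (f k) -> e (f j) (f l) -> False.
Proof.
move=> fI fstep close ij jk kl ln.
have A1 (m m' : nat) : (l <= m < n) || (m <= i) -> j <= m' <= k ->
  [/\ m < n, m' < n & m <> m'] by move=> *; split; lia.
have A2 (m m' : nat) : k <= m <= l -> i <= m' <= j ->
  [/\ m < n, m' < n & m <> m'] by move=> *; split; lia.
have A3 (m : nat) : l <= m <= n.-1 -> (l <= m < n) || (m <= i) by lia.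
have A4 (m : nat) : 0 <= m <= i -> (l <= m < n) || (m <= i) by lia.
have [B1 B2 B3 B4 B5] : [/\ l <= n.-1 < n, 0 <= i < n, j <= k < n, k <= l < n & i <= j < n].
  by split; lia.
have [[nil nlj nlk] [nij nik njk]] :
  [/\ l <> i, l <> j & l <> k] /\ [/\ i <> j, i <> k & j <> k] by do 2!split; lia.
have [[ni nj] [nk nl]] : (i < n /\ j < n) /\ (k < n /\ l < n) by do 2!split; lia.
move=> eik ejl.
have stp (a b : nat) : a <= b < n -> exists p, [/\ path e (f a) p, last (f a) p = f b &
   forall u, u \in f a :: p -> exists2 m, a <= m <= b & u = f m].
  move=> /andP[ab bn]; elim: b ab bn => [|b IH].
    rewrite leqn0 => /eqP-> _; exists [::]; split=> // u.
    by rewrite inE => /eqP->; exists 0.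
  rewrite leq_eqVlt => /orP[/eqP-> bn|].
    by exists [::]; split=> // u; rewrite inE => /eqP->; exists b.+1; rewrite ?leqnn.
  rewrite ltnS => ab bn; have [p [ap lp inp]] := IH ab (ltnW bn).
  exists (rcons p (f b.+1)); split; rewrite ?last_rcons // ?rcons_path ?ap ?lp ?fstep //.
  move=> u; rewrite -rcons_cons mem_rcons inE => /orP[/eqP->|/inp[m /andP[am mb] ->]].
    by exists b.+1 => //; rewrite leqnn (leq_trans ab).
  by exists m => //; rewrite am (leq_trans mb).
have qp a b a' b' p p' : path e a p -> last a p = b -> path e a' p' -> last a' p' = b' ->
    {in a :: p, forall x, x \notin a' :: p'} -> quad a b a' b' = false.
  by move=> h1 <- h2 <-; exact: quad_path.
have [p1 [lp1 ep1 mp1]] : exists p, [/\ path e (f l) p, last (f l) p = f i &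
    forall u, u \in f l :: p -> exists2 m : nat, (l <= m < n) || (m <= i) & u = f m].
  have [q1 [h1 h2 h3]] := stp _ _ B1; have [q2 [h4 h5 h6]] := stp _ _ B2.
  exists (q1 ++ f 0 :: q2); split.
  - by rewrite cat_path h1 h2 /= close h4.
  - by rewrite last_cat.
  - move=> u; rewrite -cat_cons mem_cat => /orP[/h3|/h6][m hm ->]; exists m => //.
    + exact: A3.
    + exact: A4.
have [p2 [jp2 ep2 mp2]] := stp _ _ B3.
have [p3 [kp3 ep3 mp3]] := stp _ _ B4.
have [p4 [ip4 ep4 mp4]] := stp _ _ B5.
have nf (a b : nat) : a < n -> b < n -> a <> b -> f a != f b.
  by move=> ha hb ab; apply/eqP => /fI; exact: (fun h => ab (h ha hb)).
apply: (@no_crossing (f l) (f i) (f j) (f k)).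
- by rewrite /= !inE !negb_or !nf.
- apply: (qp _ _ _ _ p1 p2) => // u /mp1[m hm ->]; apply/negP => /mp2[m' hm'].
  by have [h1 h2 h3] := A1 _ _ hm hm' => /(fI _ _ h1 h2).
- apply: (qp _ _ _ _ [:: f j] [:: f k]); rewrite /= ?eik 1?esym ?ejl //.
  by move=> u; rewrite !inE => /orP[] /eqP->; rewrite negb_or !nf //; exact: nesym.
- rewrite /quad addbC; apply: (qp (f k) (f l) (f i) (f j) p3 p4) => // u /mp3[m hm ->].
  by apply/negP => /mp4[m' hm']; have [h1 h2 h3] := A2 _ _ hm hm' => /(fI _ _ h1 h2).
Qed.

Lemma even_tournament_reducible : (exists u, 0 < deg u) ->
  (forall u, deg u != 1) -> reducible.
Proof.
move=> [u0 du0] deg1.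
have deg_ge2 u : 0 < deg u -> 1 < deg u by have := deg1 u; case: (deg u) => [|[]].
(* The non-isolated vertices form a lobe at any one of them, so a smallest lobe exists. *)
have lobe0 : lobe [set u | 0 < deg u] u0.
  apply/and3P; split; first by rewrite inE.
    have := du0; rewrite /deg card_gt0 => /set0Pn[w]; rewrite inE => uw.
    apply/eqP => /setP/(_ w); rewrite !inE.
    have -> : 0 < deg w by apply/card_gt0P; exists u0; rewrite inE esym.
    move=> h; have /eqP wu : w == u0 by rewrite -h.
    by rewrite wu eirr in uw.
  apply/forallP => u; apply/implyP; rewrite inE => du; apply/implyP => _.
  rewrite du; apply/forallP => w; apply/implyP => uw; rewrite inE.
  by apply/card_gt0P; exists u; rewrite inE esym.
case: (@arg_minnP ({set V} * V)%type ([set u | 0 < deg u], u0)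
  (fun Bc => lobe Bc.1 Bc.2) (fun Bc => #|Bc.1|) lobe0).
case=> B c /= lobeB minB.
have {}minB B' c' : lobe B' c' -> #|B| <= #|B'| by move=> h; exact: (minB (B', c')).
have [s0 cs0 s0B] := hamiltonian lobeB minB deg_ge2.
have cs0' : c \in s0 by rewrite s0B; case/and3P: lobeB.
(* The cycle is rotated to start at [c], the one vertex that may have neighbours outside [B]. *)
have [i0 s1 sE] := rot_to cs0'.
have : cyc B (c :: s1) by rewrite -sE cyc_rot.
have : c :: s1 =i B by move=> u; rewrite -sE mem_rot.
have : head c (c :: s1) = c by [].
move: (c :: s1) => s sc sB cs {s1 sE i0 s0 cs0 s0B cs0'}.
case/and4P: cs => us cys ss _.
apply: (@outer_cycle_reducible (size s) (nth c s)) => //.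
- move=> i j hi hj /eqP; rewrite nth_uniq // => /eqP //.
- move=> i hi; case: s cys hi {us ss sB sc} => //= a s; rewrite rcons_path => /andP[as_ _].
  by move=> hi; have /pathP/(_ i) := as_; apply.
- case: s cys ss {us sB sc} => //= a s; rewrite rcons_path => /andP[_ la] _.
  by rewrite -[X in nth _ _ X]/(size s) -last_nth esym.
- move=> i w /andP[i0 hi] iw.
  have iB : nth c s i \in B by rewrite -sB mem_nth.
  have ic : nth c s i != c.
    have E : nth c s 0 = c by rewrite nth0 sc.
    by rewrite -[X in _ != X]E nth_uniq ?(leq_ltn_trans _ hi) // -lt0n.
  have : w \in s by rewrite sB; exact: lobe_closed lobeB iB ic iw.
  by move=> ws; exists (index w s); rewrite ?index_mem ?nth_index.
move=> i j k l ij jk kl ln eik ejl.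
apply: (@cycle_no_crossing (size s) (nth c s) i j k l) => //.
- by move=> a b ha hb /eqP; rewrite nth_uniq // => /eqP.
- move=> b; case: s cys {us ss sB sc ln eik ejl} => //= a s.
  by rewrite rcons_path => /andP[as_ _] hb; have /pathP/(_ b) := as_; apply.
- case: s cys ss {us sB sc ln eik ejl} => //= a s.
  by rewrite rcons_path => /andP[_ la] _; rewrite -[X in nth _ _ X]/(size s) -last_nth.
Qed.

End Structure.

(** * Arc colourings *)

Section ArcColorings.
Variables (V : finType) (D : nat).
Local Notation coloring := (V -> V -> 'I_D -> bool).
Implicit Types (C L : coloring) (e P : rel V) (u v w x y : V) (k a b : 'I_D).

(* [C u v k] says that the incidence (u, uv), viewed as the arc from u to v,
   has colour k; arcs off the support of C are uncoloured. *)
Definition proper C := [/\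
  forall u v k k', C u v k -> C u v k' -> k = k',
  forall u v k, C u v k -> exists k', C v u k',
  forall u v k, C u v k -> ~~ C v u k,
  forall u v w k, C u v k -> C u w k -> v = w &
  forall u v w k, C v u k -> C w u k -> v = w].

Definition supports e C := forall u v, e u v = [exists k, C u v k].

Definition free_out C u := [set k | [forall v, ~~ C u v k]].
Definition free_in C u := [set k | [forall v, ~~ C v u k]].

(* As [free_out C u] has [D - deg e u] elements, this is condition (d). *)
Definition saturated C := forall u, #|free_out C u| <= 1 -> free_out C u :&: free_in C u = set0.

Definition colorable e := exists C, [/\ proper C, supports e C & saturated C].

Lemma free_outP C u k : reflect (forall v, ~~ C u v k) (k \in free_out C u).
Proof. by rewrite inE; exact: forallP. Qed.

Lemma free_inP C u k : reflect (forall v, ~~ C v u k) (k \in free_in C u).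
Proof. by rewrite inE; exact: forallP. Qed.

Lemma card_free_out C e u : proper C -> supports e C -> #|free_out C u| = D - deg e u.
Proof.
move=> [p1 _ _ p4 _] sup; pose S := [set z : V * 'I_D | C u z.1 z.2].
have -> : deg e u = #|S|.
  rewrite -(card_in_imset (f := fst) (D := S)); last first.
    by move=> [v k] [v' k']; rewrite !inE /= => h1 + vv'; rewrite -vv' => /(p1 _ _ _ _ h1) ->.
  apply: eq_card => v; rewrite !inE sup.
  apply/existsP/imsetP => [[k h]|[[v' k]]]; last by rewrite inE /= => h ->; exists k.
  by exists (v, k); rewrite ?inE.
have -> : #|free_out C u| = #|~: (snd @: S)|.
  apply: eq_card => k; rewrite [RHS]inE; apply/free_outP/negP => [h /imsetP[[v k']]|h v].
    by rewrite inE /= => Ck kk'; move: Ck; rewrite -kk'; apply/negP.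
  by apply/negP => Ck; apply: h; apply/imsetP; exists (v, k); rewrite ?inE.
rewrite cardsCs setCK card_ord card_in_imset // => -[v k] [v' k'].
by rewrite !inE /= => h1 + kk'; rewrite -kk' => /(p4 _ _ _ _ h1) ->.
Qed.

Lemma card_free_in C e u : symmetric e -> proper C -> supports e C ->
  #|free_in C u| = D - deg e u.
Proof.
move=> es [p1 p2 p3 p4 p5] sup.
(* Reversing all arcs preserves [proper] and swaps the two kinds of free colours. *)
rewrite -(@card_free_out (fun x y k => C y x k)) //.
- split=> [x y k k'|x y k|x y k|x y z k|x y z k];
    [exact: p1|exact: p2|exact: p3|exact: p5|exact: p4].
- by move=> x y; rewrite es sup.
Qed.

Lemma card_free_out_free_in C e u : symmetric e -> proper C -> supports e C ->
  #|free_in C u| = #|free_out C u|.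
Proof. by move=> es pC sC; rewrite (card_free_in u es pC sC) (card_free_out u pC sC). Qed.

Definition union C L : coloring := fun u v k => C u v k || L u v k.

Lemma free_out_union C L u : free_out (union C L) u = free_out C u :&: free_out L u.
Proof.
apply/setP => k; rewrite [RHS]inE; apply/free_outP/andP => [h|[/free_outP h1 /free_outP h2] v].
  by split; apply/free_outP => v; have := h v; rewrite negb_or => /andP[].
by rewrite negb_or h1 h2.
Qed.

Lemma free_in_union C L u : free_in (union C L) u = free_in C u :&: free_in L u.
Proof.
apply/setP => k; rewrite [RHS]inE; apply/free_inP/andP => [h|[/free_inP h1 /free_inP h2] v].
  by split; apply/free_inP => v; have := h v; rewrite negb_or => /andP[].
by rewrite negb_or h1 h2.
Qed.

(** Both arcs of an edge lie in the same summand, so a conflict between the summands could only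
    arise among arcs leaving, or arcs entering, one vertex. *)
Lemma proper_union C L : proper C -> proper L ->
  (forall u v k k', C u v k -> ~~ L u v k') ->
  (forall u v k, L u v k -> (k \in free_out C u) && (k \in free_in C v)) ->
  proper (union C L).
Proof.
move=> [c1 c2 c3 c4 c5] [l1 l2 l3 l4 l5] dis free.
have no u v k k' : C u v k -> L u v k' -> False.
  by move=> h; apply/negP/(dis _ _ _ _ h).
have nout u v w k : C u v k -> L u w k -> False.
  by move=> h /free/andP[/free_outP/(_ v)]; rewrite h.
have nin u v w k : C v u k -> L w u k -> False.
  by move=> h /free/andP[_ /free_inP/(_ v)]; rewrite h.
split.
- move=> u v k k' /orP[] h /orP[] h'; [exact: c1 h h'|by case: (no _ _ _ _ h h')|
    by case: (no _ _ _ _ h' h)|exact: l1 h h'].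
- move=> u v k /orP[/c2|/l2] [k' h]; exists k'; by rewrite /union h ?orbT.
- move=> u v k /orP[] h; rewrite negb_or; apply/andP; split.
  + exact: c3.
  + by apply/negP => /l2[k' /(no _ _ _ _ h)].
  + by apply/negP => /c2[k' h']; exact: no h' h.
  + exact: l3.
- move=> u v w k /orP[] h /orP[] h'; [exact: c4 h h'|by case: (nout _ _ _ _ h h')|
    by case: (nout _ _ _ _ h' h)|exact: l4 h h'].
- move=> u v w k /orP[] h /orP[] h'; [exact: c5 h h'|by case: (nin _ _ _ _ h h')|
    by case: (nin _ _ _ _ h' h)|exact: l5 h h'].
Qed.

Definition del e P : rel V := fun u v => e u v && ~~ P u v.

Lemma supports_union e P C L : subrel P e -> supports (del e P) C ->
  supports P L -> supports e (union C L).
Proof.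
move=> sPe sC sL u v; apply/idP/existsP => [euv|[k /orP[h|h]]].
- have [/[!sL]/existsP[k h]|nP] := boolP (P u v); first by exists k; rewrite /union h orbT.
  have : del e P u v by rewrite /del euv.
  by rewrite sC => /existsP[k h]; exists k; rewrite /union h.
- have : del e P u v by rewrite sC; apply/existsP; exists k.
  by case/andP.
- by apply: sPe; rewrite sL; apply/existsP; exists k.
Qed.

Lemma supports_del_disjoint e P C L u v k k' : supports (del e P) C ->
  supports P L -> C u v k -> ~~ L u v k'.
Proof.
move=> sC sL h; apply/negP => h'.
have : del e P u v by rewrite sC; apply/existsP; exists k.
by rewrite /del sL => /andP[_ /existsP[]]; exists k'.
Qed.

Lemma deg_del e P u (ws : seq V) : uniq ws ->
  (forall v, e u v && P u v = (v \in ws)) -> deg (del e P) u + size ws = deg e u.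
Proof.
move=> uws h; rewrite /deg.
rewrite -(cardsID [set v | P u v] [set v | e u v]) addnC; congr (_ + _).
  rewrite -(card_uniqP uws); apply: eq_card => v; by rewrite !inE -h.
by apply: eq_card => v; rewrite !inE /del; case: (e u v); case: (P u v).
Qed.

Lemma full_free_out C e u : proper C -> supports e C -> deg e u = 0 -> free_out C u = setT.
Proof.
move=> pC sC d0; apply/eqP; rewrite eqEcard subsetT cardsT card_ord.
by rewrite (card_free_out u pC sC) d0 subn0 leqnn.
Qed.

Lemma full_free_in C e u : symmetric e -> proper C -> supports e C -> deg e u = 0 ->
  free_in C u = setT.
Proof.
move=> es pC sC d0; apply/eqP; rewrite eqEcard subsetT cardsT card_ord.
by rewrite (card_free_in u es pC sC) d0 subn0 leqnn.
Qed.

Lemma saturated_low C e u : proper C -> supports e C -> deg e u + 2 <= D ->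
  #|free_out C u| <= 1 -> free_out C u :&: free_in C u = set0.
Proof. by move=> pC sC; rewrite (card_free_out u pC sC); lia. Qed.

Definition pair_rel x y : rel V :=
  fun u v => ((u == x) && (v == y)) || ((u == y) && (v == x)).

Definition edge x y a b : coloring := fun u v k =>
  [&& u == x, v == y & k == a] || [&& u == y, v == x & k == b].

Lemma edge_proper x y a b : x != y -> a != b -> proper (edge x y a b).
Proof.
move=> xy ab; have yx : (y == x) = false by rewrite eq_sym (negbTE xy).
have ba : (b == a) = false by rewrite eq_sym (negbTE ab).
split.
- move=> u v k k' /orP[]/and3P[/eqP-> /eqP-> /eqP->];
  by rewrite /edge !eqxx ?(negbTE xy) ?yx ?orbF /= => /eqP->.
- move=> u v k /orP[]/and3P[/eqP-> /eqP-> _]; [exists b | exists a];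
  by rewrite /edge !eqxx ?orbT.
- move=> u v k /orP[]/and3P[/eqP-> /eqP-> /eqP->];
  by rewrite /edge !eqxx ?(negbTE xy) ?yx ?(negbTE ab) ?ba.
- move=> u v w k /orP[]/and3P[/eqP-> /eqP-> /eqP->];
  by rewrite /edge !eqxx ?(negbTE xy) ?yx ?(negbTE ab) ?ba ?andbT ?andbF ?orbF //= => /eqP->.
- move=> u v w k /orP[]/and3P[/eqP-> /eqP-> /eqP->];
  by rewrite /edge !eqxx ?(negbTE xy) ?yx ?(negbTE ab) ?ba ?andbT ?andbF ?orbF //= => /eqP->.
Qed.

Lemma edge_supports x y a b : supports (pair_rel x y) (edge x y a b).
Proof.
move=> u v; apply/orP/existsP => [[]/andP[/eqP-> /eqP->]|[k /orP[]/and3P[h1 h2 _]]].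
- by exists a; rewrite /edge !eqxx.
- by exists b; rewrite /edge !eqxx orbT.
- by left; rewrite h1 h2.
- by right; rewrite h1 h2.
Qed.

Section AddEdge.
Variables (C : coloring) (x y : V) (a b : 'I_D).
Hypotheses (pC : proper C) (xy : x != y) (ab : a != b).
Hypotheses (nC : forall k, ~~ C x y k) (nC' : forall k, ~~ C y x k).
Hypotheses (ax : a \in free_out C x) (ay : a \in free_in C y).
Hypotheses (bx : b \in free_in C x) (by_ : b \in free_out C y).

Definition add := union C (edge x y a b).

Lemma add_proper : proper add.
Proof.
apply: proper_union => //; first exact: edge_proper.
- move=> u v k k' h; apply/negP => /orP[]/and3P[/eqP uE /eqP vE _];
  by move: h; rewrite uE vE; apply/negP.
- by move=> u v k /orP[]/and3P[/eqP-> /eqP-> /eqP->]; apply/andP.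
Qed.

Let yx : (y == x) = false. Proof. by rewrite eq_sym (negbTE xy). Qed.

Lemma add_free_out_l : free_out add x = free_out C x :\ a.
Proof.
apply/setP => k; rewrite free_out_union !inE andbC; congr (_ && _).
apply/forallP/idP => [/(_ y)|ka v]; rewrite /edge !eqxx ?(negbTE xy) ?orbF //=.
by rewrite (negbTE ka) andbF.
Qed.

Lemma add_free_out_r : free_out add y = free_out C y :\ b.
Proof.
apply/setP => k; rewrite free_out_union !inE andbC; congr (_ && _).
apply/forallP/idP => [/(_ x)|ka v]; rewrite /edge !eqxx ?yx //=.
by rewrite (negbTE ka) andbF.
Qed.

Lemma add_free_in_l : free_in add x = free_in C x :\ b.
Proof.
apply/setP => k; rewrite free_in_union !inE andbC; congr (_ && _).
apply/forallP/idP => [/(_ y)|ka v]; rewrite /edge !eqxx ?(negbTE xy) ?andbF //=.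
by rewrite (negbTE ka) andbF.
Qed.

Lemma add_free_in_r : free_in add y = free_in C y :\ a.
Proof.
apply/setP => k; rewrite free_in_union !inE andbC; congr (_ && _).
apply/forallP/idP => [/(_ x)|ka v]; rewrite /edge !eqxx ?yx ?andbF ?orbF //=.
by rewrite (negbTE ka) andbF.
Qed.

Lemma add_free_out_o u : u != x -> u != y -> free_out add u = free_out C u.
Proof.
move=> ux uy; apply/setP => k; rewrite free_out_union inE andbC.
by have -> // : k \in free_out (edge x y a b) u; apply/free_outP => v;
  rewrite /edge (negbTE ux) (negbTE uy).
Qed.

Lemma add_free_in_o u : u != x -> u != y -> free_in add u = free_in C u.
Proof.
move=> ux uy; apply/setP => k; rewrite free_in_union inE andbC.
by have -> // : k \in free_in (edge x y a b) u; apply/free_inP => v;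
  rewrite /edge (negbTE ux) (negbTE uy) !andbF.
Qed.

End AddEdge.

End ArcColorings.

(** * Choosing free colours from small sets *)

Lemma pick_pair (T : eqType) (x1 x2 y1 y2 : T) : x1 != x2 -> y1 != y2 ->
  (x1 != y1) && (x2 != y2) || (x1 != y2) && (x2 != y1).
Proof. by do !case: eqP => //=; congruence. Qed.

(** From each pair, [p] and [q] are to be used while [p'] and [q'] stay free. The [bad] patterns say
    that the pairs consist of [a], [b] respectively and a common third colour. *)
Lemma pick_ear (T : eqType) (x1 x2 y1 y2 a b : T) :
  x1 != x2 -> y1 != y2 -> a != b ->
  let good p p' q q' := [&& p != a, q != b, p != q & p' != q'] in
  let bad p p' q q' := [&& p == a, q == b & p' == q'] in
  [|| good x1 x2 y1 y2, good x1 x2 y2 y1, good x2 x1 y1 y2, good x2 x1 y2 y1,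
      bad x1 x2 y1 y2, bad x1 x2 y2 y1, bad x2 x1 y1 y2 | bad x2 x1 y2 y1].
Proof. by move=> h1 h2 h3 /=; move: h1 h2 h3; do !case: eqP => //=; congruence. Qed.

Lemma card_setD1_le (T : finType) (A : {set T}) x n : n.+1 <= #|A| -> n <= #|A :\ x|.
Proof. by move=> h; move: (cardsD1 x A) (leq_b1 (x \in A)) h; lia. Qed.

Lemma setD1_pair (T : finType) (x y : T) : x != y -> [set x; y] :\ x = [set y].
Proof.
move=> xy; apply/setP => z; rewrite !inE; case: eqVneq => [->|] //=.
by rewrite (negbTE xy).
Qed.

Lemma set1I_disjoint (T : finType) (x y : T) : x != y -> [set x] :&: [set y] = set0.
Proof. by move=> xy; apply/disjoint_setI0; rewrite disjoints1 inE. Qed.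

Section Picking.
Variable T : finType.
Implicit Types (S U : {set T}) (a b : T).

(** [S] and [U] are the free outgoing and incoming colours where a leaf edge is added. With one
    colour each, saturation already makes them distinct; with two, they can be matched so that the
    leftovers differ; with more, at least two are left and there is nothing to preserve. *)
Lemma pick_leaf S U : 0 < #|S| -> #|U| = #|S| ->
  (#|S| <= 1 -> S :&: U = set0) ->
  exists a b, [/\ a \in S, b \in U, a != b & #|S :\ a| <= 1 -> (S :\ a) :&: (U :\ b) = set0].
Proof.
move=> S0 US dis.
have [S1|S1] := leqP #|S| 1.
  have [a aS] := card_gt0P S0.
  have [b bU] : exists b, b \in U by apply/card_gt0P; rewrite US.
  exists a, b; split=> //.
    by apply/eqP => ab; move: (dis S1) => /setP/(_ a); rewrite !inE aS ab bU.
  move=> _; apply/eqP; rewrite -cards_eq0 -leqn0 (leq_trans (subset_leq_card (subsetIl _ _))) //.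
  by rewrite leqn0; move: (cardsD1 a S); rewrite aS; lia.
have [S2|S2] := leqP #|S| 2.
  have /cards2P[x1 [x2 [x12 SE]]] : #|S| == 2 by lia.
  have /cards2P[y1 [y2 [y12 UE]]] : #|U| == 2 by lia.
  case/orP: (pick_pair x12 y12) => /andP[h1 h2].
    exists x1, y1; rewrite SE UE !inE !eqxx; split=> // _.
    by rewrite !setD1_pair // set1I_disjoint.
  exists x1, y2; rewrite SE UE !inE !eqxx orbT; split=> // _.
  by rewrite [[set y1; _]]setUC !setD1_pair // 1?eq_sym // set1I_disjoint.
have [a aS] := card_gt0P S0.
have [b] : exists b, b \in U :\ a.
  by apply/card_gt0P; apply: card_setD1_le; lia.
rewrite !inE => /andP[ba bU]; exists a, b; split=> //; first by rewrite eq_sym.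
by have := @card_setD1_le _ S a 2 S2; lia.
Qed.

Lemma pick_free S U a b : 2 < #|S| -> 2 < #|U| -> exists p q,
  [/\ p \in S :\ a, q \in U :\ b & p != q].
Proof.
move=> S2 U2.
have [p pS] : exists p, p \in S :\ a by apply/card_gt0P; apply: card_setD1_le; lia.
have [q] : exists q, q \in U :\ b :\ p.
  by apply/card_gt0P; do 2!apply: card_setD1_le.
by rewrite in_setD1 => /andP[qp qU]; exists p, q; rewrite eq_sym.
Qed.

(** The first alternative is the only obstruction to choosing as in [pick_leaf] with [a] and [b]
    forbidden; [ear_reduction] excludes it by counting colours. *)
Lemma pick_two S U a b : #|S| = 2 -> #|U| = 2 -> a != b ->
  (exists c, [/\ S = [set a; c], U = [set b; c], a != c & b != c]) \/
  exists p q, [/\ p \in S :\ a, q \in U :\ b, p != q & (S :\ p) :&: (U :\ q) = set0].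
Proof.
move=> /eqP/cards2P[x1 [x2 [x12 ->]]] /eqP/cards2P[y1 [y2 [y12 ->]]] ab.
have good p p' q q' : p != p' -> q != q' -> [&& p != a, q != b, p != q & p' != q'] ->
    [/\ p \in [set p; p'] :\ a, q \in [set q; q'] :\ b, p != q &
      ([set p; p'] :\ p) :&: ([set q; q'] :\ q) = set0].
  move=> pp' qq' /and4P[h1 h2 h3 h4]; rewrite !inE !eqxx h1 h2; split=> //.
  by rewrite !setD1_pair // set1I_disjoint.
have bad p p' q q' : p != p' -> q != q' -> [&& p == a, q == b & p' == q'] ->
    [/\ [set p; p'] = [set a; p'], [set q; q'] = [set b; p'], a != p' & b != p'].
  move=> pp' qq' /and3P[/eqP pa /eqP qb /eqP pq]; rewrite -pa -qb.
  by split=> //; rewrite pq.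
have [x21 y21] : x2 != x1 /\ y2 != y1 by rewrite !(eq_sym x2) !(eq_sym y2).
have := pick_ear x12 y12 ab => /= /or4P[h|h|h|].
- by right; exists x1, y1; exact: good.
- by right; exists x1, y2; rewrite [[set y1; _]]setUC; exact: good.
- by right; exists x2, y1; rewrite [[set x1; _]]setUC; exact: good.
case/or4P => [h|h|h|].
- by right; exists x2, y2; rewrite [[set x1; _]]setUC [[set y1; _]]setUC; exact: good.
- by left; exists x2; exact: bad h.
- by left; exists x2; rewrite [[set y1; _]]setUC; exact: bad h.
case/orP => [h|h].
- by left; exists x1; rewrite [[set x1; _]]setUC; exact: bad h.
- by left; exists x1; rewrite [[set x1; _]]setUC [[set y1; _]]setUC; exact: bad h.
Qed.

(** Fixing the colours before the configuration is coloured makes saturation at its ends independent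
    of how they get used. Only [#|S| = n.+1] needs care: one colour of each kind is left over, and
    these must differ. *)
Lemma reserve n S U : 1 < n -> n <= #|S| -> #|U| = #|S| -> exists S' U',
  [/\ S' \subset S, U' \subset U, #|S'| = n, #|U'| = n &
      #|S :\: S'| <= 1 -> (S :\: S') :&: (U :\: U') = set0].
Proof.
move=> n1 nS US.
have sub (A : {set T}) : n <= #|A| -> exists A' : {set T}, A' \subset A /\ #|A'| = n.
  move=> nA; have /card_geqP[s [us ss sA]] := nA; exists [set x in s]; split.
    by apply/subsetP => x; rewrite inE => /sA.
  by rewrite cardsE (card_uniqP us).
have cardD (A A' : {set T}) : A' \subset A -> #|A :\: A'| = #|A| - #|A'|.
  by move=> h; rewrite cardsD (setIidPr h).
have [SE|Sn] := eqVneq #|S| n.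
  exists S, U; split; rewrite ?US //.
  by rewrite !setDv set0I.
have [SE1|Sn1] := eqVneq #|S| n.+1; last first.
  have [S' [sS' cS']] := sub S nS; have [|U' [sU' cU']] := sub U; first by rewrite US.
  by exists S', U'; split=> //; rewrite cardD // cS'; lia.
have [a aS] : exists a, a \in S by apply/card_gt0P; lia.
have [b] : exists b, b \in U :\ a by apply/card_gt0P; apply: card_setD1_le; lia.
rewrite !inE => /andP[ba bU].
exists (S :\ a), (U :\ b); rewrite !subD1set; split=> //.
- by have := cardsD1 a S; rewrite aS; lia.
- by have := cardsD1 b U; rewrite bU; lia.
move=> _; have DD (A : {set T}) x : x \in A -> A :\: (A :\ x) = [set x].
  by move=> xA; rewrite setDDr setDv set0U; apply/setIidPr; rewrite sub1set.
by rewrite !DD // set1I_disjoint // eq_sym.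
Qed.

End Picking.

(** * Extending colourings by finite search *)

(* A local colouring is a list of ((i, j), k): the arc from vertex i to vertex
   j of a configuration has colour k. [ao] and [ai] list, for each vertex, the
   colours allowed on its outgoing and incoming arcs; [full] lists vertices at
   which all allowed colours must be used, [cov] those at which every colour
   must occur. *)
Section LocalColorings.
Variables (D m : nat) (arcs : seq (nat * nat)) (full cov : seq nat).
Implicit Types (ao ai : seq (seq nat)) (l : seq (nat * nat * nat)).

Definition outs l i := [seq z.2 | z <- l & z.1.1 == i].
Definition ins l i := [seq z.2 | z <- l & z.1.2 == i].

Definition compatible (z z' : nat * nat * nat) :=
  [&& (z.1 == z'.1) ==> (z.2 == z'.2),
      (z.1.1 == z'.1.1) && (z.2 == z'.2) ==> (z.1.2 == z'.1.2),
      (z.1.2 == z'.1.2) && (z.2 == z'.2) ==> (z.1.1 == z'.1.1) &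
      (z.1.1 == z'.1.2) && (z.1.2 == z'.1.1) ==> (z.2 != z'.2)].

Definition valid ao ai l :=
  [&& all (fun z => [&& z.1.1 < m, z.1.2 < m, z.2 < D, z.1 \in arcs,
             z.2 \in nth [::] ao z.1.1 & z.2 \in nth [::] ai z.1.2]) l,
      all (fun z => all (compatible z) l) l,
      all (fun p => ((p.2, p.1) \in arcs) && has (fun z => z.1 == p) l) arcs,
      all (fun i => all (fun k => k \in outs l i) (nth [::] ao i) &&
                    all (fun k => k \in ins l i) (nth [::] ai i)) full &
      all (fun i => all (fun k => k \in outs l i ++ ins l i) (iota 0 D)) cov].

Fixpoint solve ao ai todo l : option (seq (nat * nat * nat)) :=
  if todo is (i, j) :: todo' then
    (fix try ks := if ks is k :: ks' then
       if (k \in nth [::] ai j) && all (compatible (i, j, k)) l then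
         if solve ao ai todo' ((i, j, k) :: l) is Some r then Some r else try ks'
       else try ks' else None) (nth [::] ao i)
  else if valid ao ai l then Some l else None.

(** Every completed list is checked again by [valid], so the pruning in [solve] needs no correctness
    proof. *)
Lemma solve_valid ao ai : isSome (solve ao ai arcs [::]) -> exists l, valid ao ai l.
Proof.
elim: arcs [::] => [|[i j] todo IH] l /=; first by case: ifP => // h _; exists l.
elim: (nth [::] ao i) => // k ks IHks /=; case: ifP => // _.
by case E: (solve _ _ _ _) => [r|//] _; apply: (IH ((i, j, k) :: l)); rewrite E.
Qed.

End LocalColorings.

Fixpoint sublists (s : seq nat) : seq (seq nat) :=
  if s is x :: s' then map (cons x) (sublists s') ++ sublists s' else [:: [::]].

Lemma filter_sublists (p : pred nat) s : filter p s \in sublists s.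
Proof.
elim: s => //= x s IH; case: ifP => _; rewrite mem_cat.
  by rewrite map_f.
by rewrite IH orbT.
Qed.

Definition choices n D := [seq s <- sublists (iota 0 D) | size s == n].

Section LocalReduction.
Variables (V : finType) (D : nat) (e : rel V).
Hypothesis esym : symmetric e.
Variables (vs : seq V) (arcs : seq (nat * nat)).
Hypothesis uvs : uniq vs.

Definition local_rel : rel V := fun u v => (index u vs, index v vs) \in arcs.

Section Lift.
Variables (cs : seq 'I_D) (full cov : seq nat) (ao ai : seq (seq nat)).
Variable l : seq (nat * nat * nat).
Hypotheses (ucs : uniq cs) (scs : size cs = D).
Hypothesis val_l : valid D (size vs) arcs full cov ao ai l.

(** The list [cs] renames the colours. A vertex outside [vs] has index [size vs], which [valid]
    admits in no entry, so it carries no lifted colour. *)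
Definition lift (u v : V) (k : 'I_D) := (index u vs, index v vs, index k cs) \in l.

Let mem_cs k : k \in cs.
Proof.
have sub : {subset cs <= enum 'I_D} by move=> i _; rewrite mem_enum.
have [|_ ->] := uniq_min_size ucs sub; last by rewrite mem_enum.
by rewrite scs size_enum_ord.
Qed.

Let index_vs u v : index u vs = index v vs -> index u vs < size vs -> u = v.
Proof.
rewrite index_mem => h uv; rewrite -(nth_index u uv) h nth_index //.
by rewrite -index_mem -h index_mem.
Qed.

Let index_cs (k k' : 'I_D) : index k cs = index k' cs -> k = k'.
Proof. by move=> h; rewrite -(nth_index k (mem_cs k)) h nth_index. Qed.

Let l_entry u v k : lift u v k -> [/\ index u vs < size vs, index v vs < size vs,
  (index u vs, index v vs) \in arcs,
  index k cs \in nth [::] ao (index u vs) & index k cs \in nth [::] ai (index v vs)].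
Proof. by move=> h; case/and5P: val_l => /allP/(_ _ h)/and5P[/= -> -> _ -> /andP[-> ->]]. Qed.

Let l_comp u v k u' v' k' : lift u v k -> lift u' v' k' ->
  compatible (index u vs, index v vs, index k cs) (index u' vs, index v' vs, index k' cs).
Proof. by move=> h h'; case/and5P: val_l => _ /allP/(_ _ h)/allP/(_ _ h'). Qed.

Lemma lift_supports : supports local_rel lift.
Proof.
move=> u v; apply/idP/existsP => [h|[k /l_entry[]//]].
case/and5P: val_l => /allP al _ /allP/(_ _ h)/andP[_ /hasP[z zl /eqP zE]] _ _.
have /and5P[_ _ zD _ _] := al z zl.
have k0 : 'I_D by case: (D) zD => // n _; exact: ord0.
by exists (nth k0 cs z.2); rewrite /lift index_uniq ?scs // -zE -surjective_pairing.
Qed.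

Lemma lift_proper : proper lift.
Proof.
split.
- move=> u v k k' h h'; have /and4P[/= c1 _ _ _] := l_comp h h'.
  by apply: index_cs; apply/eqP; move: c1; rewrite eqxx.
- move=> u v k /l_entry[_ _ ha _ _].
  case/and5P: val_l => _ _ /allP/(_ _ ha)/andP[/= hv _] _ _.
  have : local_rel v u by [].
  by rewrite lift_supports => /existsP.
- move=> u v k h; apply/negP => h'; have /and4P[/= _ _ _] := l_comp h h'.
  by rewrite !eqxx.
- move=> u v w k h h'; have /and4P[/= _ + _ _] := l_comp h h'.
  by rewrite !eqxx /= => /eqP/index_vs; apply; case: (l_entry h).
- move=> u v w k h h'; have /and4P[/= _ _ + _] := l_comp h h'.
  by rewrite !eqxx /= => /eqP/index_vs; apply; case: (l_entry h).
Qed.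

Lemma free_out_lift u k : u \in vs ->
  (k \in free_out lift u) = (index k cs \notin outs l (index u vs)).
Proof.
move=> uv; apply/free_outP/negP => [h /mapP[z]|h v].
  rewrite mem_filter => /andP[/eqP z1 zl] kz.
  case/and5P: val_l => /allP/(_ _ zl)/and5P[_ z2 _ _ _] _ _ _ _.
  move: (h (nth u vs z.1.2)); rewrite /lift index_uniq // kz -z1.
  by move/negP; apply; rewrite -!surjective_pairing.
apply/negP => hl; apply: h; apply/mapP.
by exists (index u vs, index v vs, index k cs) => //; rewrite mem_filter eqxx.
Qed.

Lemma free_in_lift u k : u \in vs ->
  (k \in free_in lift u) = (index k cs \notin ins l (index u vs)).
Proof.
move=> uv; apply/free_inP/negP => [h /mapP[z]|h v].
  rewrite mem_filter => /andP[/eqP z1 zl] kz.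
  case/and5P: val_l => /allP/(_ _ zl)/and5P[z2 _ _ _ _] _ _ _ _.
  move: (h (nth u vs z.1.1)); rewrite /lift index_uniq // kz -z1.
  by move/negP; apply; rewrite -!surjective_pairing.
apply/negP => hl; apply: h; apply/mapP.
by exists (index v vs, index u vs, index k cs) => //; rewrite mem_filter eqxx.
Qed.

Lemma free_out_lift_out u : u \notin vs -> free_out lift u = setT.
Proof.
move=> uv; apply/setP => k; rewrite [RHS]inE; apply/free_outP => v; apply/negP => /l_entry[].
by rewrite index_mem (negbTE uv).
Qed.

Lemma free_in_lift_out u : u \notin vs -> free_in lift u = setT.
Proof.
move=> uv; apply/setP => k; rewrite [RHS]inE; apply/free_inP => v; apply/negP => /l_entry[_].
by rewrite index_mem (negbTE uv).
Qed.

End Lift.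

Variables (n : nat) (u x : V).
Hypotheses (n1 : 1 < n) (ux : u != x) (uin : u \in vs) (xin : x \in vs).
Variable cov : seq nat.

Definition bounds (A : seq nat) (B : seq nat) :=
  [seq if i == index u vs then A else if i == index x vs then B else iota 0 D
    | i <- iota 0 (size vs)].

(* Up to renaming colours, the colours reserved on the arcs leaving [u] are
   0, ..., n - 1. *)
Hypothesis solvable : forall iu ox ix, iu \in choices n D -> ox \in choices n D ->
  ix \in choices n D -> exists l,
    valid D (size vs) arcs [:: index u vs; index x vs] cov
      (bounds (iota 0 n) ox) (bounds iu ix) l.

Hypothesis sub_e : subrel local_rel e.
Hypothesis inner : forall v, v \in vs -> v != u -> v != x ->
  deg (del e local_rel) v = 0 /\
  [|| deg e v + 2 <= D, deg e v == D | index v vs \in cov].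
Hypotheses (du : deg (del e local_rel) u + n = deg e u) (uD : deg e u <= D).
Hypotheses (dx : deg (del e local_rel) x + n = deg e x) (xD : deg e x <= D).

Lemma nth_bounds A B v : v \in vs -> nth [::] (bounds A B) (index v vs) =
  if v == u then A else if v == x then B else iota 0 D.
Proof.
move=> vin; have vI w : w \in vs -> (index v vs == index w vs) = (v == w).
  move=> wv; apply/eqP/eqP => [h|->//].
  by rewrite -(nth_index v vin) h nth_index.
by rewrite (nth_map 0) ?size_iota ?index_mem // nth_iota ?index_mem // add0n !vI.
Qed.

Lemma local_rel_sym : symmetric local_rel.
Proof.
have [l] : exists l, valid D (size vs) arcs [:: index u vs; index x vs] cov
      (bounds (iota 0 n) (iota 0 n)) (bounds (iota 0 n) (iota 0 n)) l.
  have nD : n <= D by lia.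
  have h : iota 0 n \in choices n D.
    rewrite mem_filter size_iota eqxx.
    have -> : iota 0 n = filter (fun i => i < n) (iota 0 D); last exact: filter_sublists.
    rewrite -(subnKC nD) iotaD filter_cat.
    rewrite (eq_in_filter (a2 := predT)) ?filter_predT; last first.
      by move=> i; rewrite mem_iota add0n.
    rewrite (eq_in_filter (a2 := pred0)) ?filter_pred0 ?cats0 // => i.
    by rewrite mem_iota add0n => /andP[h _]; rewrite ltnNge h.
  exact: solvable.
case/and5P => _ _ /allP h _ _ v w.
by apply/idP/idP => /h /andP[].
Qed.

(** The rest of the graph is coloured first, and [n] colours of each kind are reserved at both [u]
    and [x]. The list found by the search uses up exactly these, which leaves both ends saturated.
    An inner vertex has all its edges in the configuration; it is saturated because at least two
    outgoing colours stay free, or none, or because the search made it see every colour. *)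
Lemma local_reduction : colorable D (del e local_rel) -> colorable D e.
Proof.
move=> [C [pC sC satC]].
have ds : symmetric (del e local_rel).
  by move=> v w; rewrite /del esym local_rel_sym.
have cu : n <= #|free_out C u| by rewrite (card_free_out u pC sC); lia.
have cx : n <= #|free_out C x| by rewrite (card_free_out x pC sC); lia.
have [Ou [Iu [sOu sIu cOu cIu leftu]]] := reserve n1 cu (card_free_out_free_in u ds pC sC).
have [Ox [Ix [sOx sIx cOx cIx leftx]]] := reserve n1 cx (card_free_out_free_in x ds pC sC).
(* [Ou] comes first, so that [index k cs < n] holds exactly for its elements. *)
pose cs := enum Ou ++ enum (~: Ou).
have ucs : uniq cs.
  rewrite cat_uniq !enum_uniq andbT /=; apply/hasPn => k.
  by rewrite !mem_enum inE.
have scs : size cs = D by rewrite size_cat -!cardE cardsC card_ord.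
pose enc (O : {set 'I_D}) := [seq i <- iota 0 D | i \in [seq index k cs | k <- enum O]].
have kcs (k : 'I_D) : k \in cs by rewrite mem_cat !mem_enum inE orbN.
have encE (O : {set 'I_D}) k : (index k cs \in enc O) = (k \in O).
  rewrite mem_filter mem_iota add0n /= -[X in _ < X]scs index_mem kcs andbT.
  apply/mapP/idP => [[k' + h]|kO]; last by exists k; rewrite ?mem_enum.
  rewrite mem_enum; suff -> : k = k' by [].
  by rewrite -(nth_index k (kcs k)) h nth_index.
have enc_choice (O : {set 'I_D}) : #|O| = n -> enc O \in choices n D.
  move=> cO; rewrite mem_filter filter_sublists andbT -cO cardE -(size_map (index^~ cs)).
  apply/eqP/perm_size/uniq_perm.
  - exact/filter_uniq/iota_uniq.
  - rewrite map_inj_in_uniq ?enum_uniq // => k k' _ _ h.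
    by rewrite -(nth_index k (kcs k)) h nth_index.
  move=> i; rewrite mem_filter mem_iota add0n /=; apply: andb_idr => /mapP[k _ ->].
  by rewrite -[X in _ < X]scs index_mem kcs.
have OuE k : (index k cs \in iota 0 n) = (k \in Ou).
  rewrite mem_iota add0n /= /cs index_cat -cOu mem_enum.
  case: ifP => kO; first by rewrite cardE index_mem mem_enum kO.
  by rewrite cardE ltnNge leq_addr.
have [l vl] := solvable (enc_choice _ cIu) (enc_choice _ cOx) (enc_choice _ cIx).
pose L := lift cs l.
have pL : proper L := lift_proper ucs scs vl.
have sL : supports local_rel L := lift_supports ucs scs vl.
have free v : v \in vs -> v != u -> v != x -> free_out C v = setT /\ free_in C v = setT.
  by move=> vv vu vx; have [d0 _] := inner vv vu vx; split;
    [exact: full_free_out d0 | exact: full_free_in d0].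
have xu : (x == u) = false by rewrite eq_sym (negbTE ux).
have pU : proper (union C L).
  apply: proper_union => //.
    by move=> v w k k'; exact: supports_del_disjoint sC sL.
  move=> v w k h; case/and5P: (vl) => /allP/(_ _ h)/and5P[/= + + _ _] + _ _ _ _.
  rewrite !index_mem => vv ww; rewrite !nth_bounds // => /andP[h1 h2].
  apply/andP; split.
    move: h1; case: eqVneq => [->|vu]; first by rewrite OuE; exact: subsetP.
    case: eqVneq => [->|vx]; first by rewrite encE; exact: subsetP.
    by have [-> _] := free v vv vu vx; rewrite inE.
  move: h2; case: eqVneq => [->|vu]; first by rewrite encE; exact: subsetP.
  case: eqVneq => [->|vx]; first by rewrite encE; exact: subsetP.
  by have [_ ->] := free w ww vu vx; rewrite inE.
have sU : supports e (union C L) by exact: supports_union sub_e sC sL.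
have used v (O I : {set 'I_D}) : v \in vs -> index v vs \in [:: index u vs; index x vs] ->
    (forall k, (index k cs \in nth [::] (bounds (iota 0 n) (enc Ox)) (index v vs)) = (k \in O)) ->
    (forall k, (index k cs \in nth [::] (bounds (enc Iu) (enc Ix)) (index v vs)) = (k \in I)) ->
    free_out (union C L) v \subset free_out C v :\: O /\
    free_in (union C L) v \subset free_in C v :\: I.
  move=> vv vb hO hI; case/and5P: (vl) => _ _ _ /allP/(_ _ vb)/andP[/allP uo /allP ui] _.
  split; apply/subsetP => k.
    rewrite free_out_union inE (free_out_lift cs vl) // => /andP[h1 h2].
    by rewrite inE h1 andbT; apply: contra h2 => kO; apply: uo; rewrite hO.
  rewrite free_in_union inE (free_in_lift cs vl) // => /andP[h1 h2].
  by rewrite inE h1 andbT; apply: contra h2 => kO; apply: ui; rewrite hI.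
have bnd v (O I : {set 'I_D}) : O \subset free_out C v -> #|O| = n ->
    (#|free_out C v :\: O| <= 1 -> (free_out C v :\: O) :&: (free_in C v :\: I) = set0) ->
    deg (del e local_rel) v + n = deg e v ->
    free_out (union C L) v \subset free_out C v :\: O ->
    free_in (union C L) v \subset free_in C v :\: I ->
    #|free_out (union C L) v| <= 1 -> free_out (union C L) v :&: free_in (union C L) v = set0.
  move=> sO cO left dv s1 s2 c1.
  apply/eqP; rewrite -subset0 -left ?setISS //.
  rewrite cardsD (setIidPr sO) cO (card_free_out v pC sC).
  by rewrite -subnDA dv -(card_free_out v pU sU).
exists (union C L); split=> // v c1.
have [vv|vv] := boolP (v \in vs); last first.
  move: c1; rewrite free_out_union free_in_union (free_out_lift_out cs vl vv).
  rewrite (free_in_lift_out cs vl vv) !setIT.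
  exact: satC.
have [vu|vu] := eqVneq v u.
  have [|||s1 s2] := used v Ou Iu vv; rewrite ?vu ?mem_head //.
  - by move=> k; rewrite nth_bounds // eqxx OuE.
  - by move=> k; rewrite nth_bounds // eqxx encE.
  by apply: (bnd u Ou Iu) => //; rewrite -vu.
have [vx|vx] := eqVneq v x.
  have [|||s1 s2] := used v Ox Ix vv; rewrite ?vx ?inE ?eqxx ?orbT //.
  - by move=> k; rewrite nth_bounds // xu eqxx encE.
  - by move=> k; rewrite nth_bounds // xu eqxx encE.
  by apply: (bnd x Ox Ix) => //; rewrite -vx.
have [_ /or3P[d2|/eqP dD|vcov]] := inner vv vu vx.
- exact: saturated_low pU sU d2 c1.
- have : #|free_out (union C L) v| = 0 by rewrite (card_free_out v pU sU) dD subnn.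
  by move=> /cards0_eq ->; rewrite set0I.
case/and5P: (vl) => _ _ _ _ /allP/(_ _ vcov)/allP h.
apply/setP => k; rewrite [RHS]inE; apply/negbTE/negP; rewrite inE => /andP[].
rewrite free_out_union free_in_union !in_setI (free_out_lift cs vl) // (free_in_lift cs vl) //.
move=> /andP[_ /negbTE h1] /andP[_ /negbTE h2]; have := h (index k cs).
by rewrite mem_iota add0n /= -[X in _ < X]scs index_mem kcs mem_cat h1 h2 => /(_ isT).
Qed.
End LocalReduction.

(** * Reductions *)

Section Reductions.
Variables (V : finType) (D : nat) (e : rel V).
Hypothesis esym : symmetric e.
Hypothesis eirr : irreflexive e.
Hypothesis D4 : 4 <= D.
Hypothesis hdeg : forall u, deg e u <= D.
Hypothesis IH : forall e' : rel V, symmetric e' -> subrel e' e ->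
  (exists a b, e a b && ~~ e' a b) -> colorable D e'.

Lemma edge_neq u v : e u v -> u != v.
Proof. by apply: contraTneq => ->; rewrite eirr. Qed.

Lemma pair_rel_sym (x y : V) : symmetric (pair_rel x y).
Proof. by move=> u v; rewrite /pair_rel; do !case: (_ == _). Qed.

Lemma del_sym (f P : rel V) : symmetric f -> symmetric P -> symmetric (del f P).
Proof. by move=> fs Ps u v; rewrite /del fs Ps. Qed.

Lemma del_sub (f P : rel V) : subrel (del f P) f.
Proof. by move=> u v /andP[]. Qed.

Lemma deg_pair_l (f : rel V) x y : f x y -> x != y ->
  deg (del f (pair_rel x y)) x + 1 = deg f x.
Proof.
move=> fxy xy; rewrite -(@deg_del _ f (pair_rel x y) x [:: y]) // => v.
rewrite inE /pair_rel eqxx (negbTE xy) orbF /=.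
by case: eqVneq => [->|]; rewrite ?andbF ?andbT.
Qed.

Lemma deg_pair_r (f : rel V) x y : f y x -> x != y ->
  deg (del f (pair_rel x y)) y + 1 = deg f y.
Proof.
move=> fxy xy; rewrite -(@deg_del _ f (pair_rel x y) y [:: x]) // => v.
rewrite inE /pair_rel eqxx eq_sym (negbTE xy) /=.
by case: (eqVneq v x) => [->|]; rewrite ?andbF ?andbT.
Qed.

Lemma deg_pair_o (f : rel V) x y z : z != x -> z != y ->
  deg (del f (pair_rel x y)) z = deg f z.
Proof.
move=> zx zy; rewrite -(@deg_del _ f (pair_rel x y) z [::]) ?addn0 // => v.
by rewrite /pair_rel (negbTE zx) (negbTE zy) andbF.
Qed.

Lemma del_pair_uncolored (f : rel V) x y (C : V -> V -> 'I_D -> bool) k :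
  supports (del f (pair_rel x y)) C -> ~~ C x y k /\ ~~ C y x k.
Proof.
move=> sC; split; apply/negP => h.
  have : del f (pair_rel x y) x y by rewrite sC; apply/existsP; exists k.
  by rewrite /del /pair_rel !eqxx andbF.
have : del f (pair_rel x y) y x by rewrite sC; apply/existsP; exists k.
by rewrite /del /pair_rel !eqxx orbT andbF.
Qed.

Lemma pair_sub (f : rel V) x y : symmetric f -> f x y -> subrel (pair_rel x y) f.
Proof. by move=> fs fxy u v /orP[]/andP[/eqP-> /eqP->] //; rewrite fs. Qed.

(** The leaf has degree at most [D - 2], so saturation only constrains the colours at [u]. *)
Lemma leaf_reduction u v : e u v -> deg e v = 1 -> colorable D e.
Proof.
move=> euv dv; have uv := edge_neq euv.
have [|||C [pC sC satC]] := IH (e' := del e (pair_rel u v)).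
- exact/del_sym/pair_rel_sym.
- exact: del_sub.
- by exists u, v; rewrite euv /del /pair_rel !eqxx andbF.
have ds : symmetric (del e (pair_rel u v)) by exact/del_sym/pair_rel_sym.
have du := deg_pair_l euv uv; have uD := hdeg u.
have dv0 : deg (del e (pair_rel u v)) v = 0.
  by have := deg_pair_r (etrans (esym v u) euv) uv; rewrite dv; clear; lia.
have [a [b [au bu ab left]]] : exists a b, [/\ a \in free_out C u, b \in free_in C u, a != b &
    #|free_out C u :\ a| <= 1 -> (free_out C u :\ a) :&: (free_in C u :\ b) = set0].
  apply: pick_leaf; [by rewrite (card_free_out u pC sC); move: du uD; clear; lia | | exact: satC].
  exact: card_free_out_free_in ds pC sC.
have av : a \in free_in C v by rewrite (full_free_in ds pC sC dv0) inE.
have bv : b \in free_out C v by rewrite (full_free_out pC sC dv0) inE.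
have nC k := del_pair_uncolored k sC.
have pC' : proper (add C u v a b).
  by apply: add_proper => // k; case: (nC k).
have sC' : supports e (add C u v a b).
  exact: supports_union (pair_sub esym euv) sC (edge_supports _ _ _ _).
exists (add C u v a b); split=> // x.
have [->|xu] := eqVneq x u.
  by rewrite add_free_out_l // add_free_in_l.
have [->|xv] := eqVneq x v.
  by apply: saturated_low pC' sC' _; rewrite dv ltnW.
by rewrite add_free_out_o // add_free_in_o //; exact: satC.
Qed.

(** Degree 2 is at most [D - 2], so saturation is vacuous at both ends. Without the edge each end
    has [D - 1] free colours of each kind; two such sets share at least [D - 2] colours, enough for
    two distinct choices. *)
Lemma edge_reduction x y : e x y -> deg e x = 2 -> deg e y = 2 -> colorable D e.
Proof.
move=> exy dx dy; have xy := edge_neq exy.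
have [|||C [pC sC satC]] := IH (e' := del e (pair_rel x y)).
- exact/del_sym/pair_rel_sym.
- exact: del_sub.
- by exists x, y; rewrite exy /del /pair_rel !eqxx andbF.
have ds : symmetric (del e (pair_rel x y)) by exact/del_sym/pair_rel_sym.
have dx1 := deg_pair_l exy xy.
have dy1 := deg_pair_r (etrans (esym y x) exy) xy.
have big (A B : {set 'I_D}) : #|A| = D - 1 -> #|B| = D - 1 -> 2 <= #|A :&: B|.
  move=> cA cB; have := cardsUI A B; have := max_card (A :|: B); rewrite card_ord.
  by move: cA cB D4; clear; lia.
have c1 : 2 <= #|free_out C x :&: free_in C y|.
  by apply: big; [rewrite (card_free_out x pC sC) | rewrite (card_free_in y ds pC sC)];
    move: dx dx1 dy dy1; clear; lia.
have c2 : 2 <= #|free_out C y :&: free_in C x|.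
  by apply: big; [rewrite (card_free_out y pC sC) | rewrite (card_free_in x ds pC sC)];
    move: dx dx1 dy dy1; clear; lia.
have [a] : exists a, a \in free_out C x :&: free_in C y by apply/card_gt0P; exact: ltnW.
rewrite inE => /andP[ax ay].
have [b] : exists b, b \in (free_out C y :&: free_in C x) :\ a.
  by apply/card_gt0P; apply: card_setD1_le.
rewrite !in_setD1 in_setI => /and3P[ba bY bX].
have nC k := del_pair_uncolored k sC.
have pC' : proper (add C x y a b).
  by apply: add_proper => //; [rewrite eq_sym | move=> k; case: (nC k)..].
have sC' : supports e (add C x y a b).
  exact: supports_union (pair_sub esym exy) sC (edge_supports _ _ _ _).
exists (add C x y a b); split=> // z.
have [->|zx] := eqVneq z x; first by apply: saturated_low pC' sC' _; rewrite dx.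
have [->|zy] := eqVneq z y; first by apply: saturated_low pC' sC' _; rewrite dy.
by rewrite add_free_out_o // add_free_in_o //; exact: satC.
Qed.

(** With both edges at [v] deleted, [u v] is restored as a leaf edge with colours [a] and [b]. Then
    the arc from [w] to [v] must avoid [a] and the arc back must avoid [b]. In the first case [w]
    has at least three free colours of each kind; in the second it has two, and the edge [u w]
    excludes the one bad pattern. *)
Lemma ear_reduction u v w : e u v -> e v w -> u != w -> deg e v = 2 ->
  deg e w + 2 <= D \/ [/\ D = 4, deg e w = 3 & e u w] -> colorable D e.
Proof.
move=> euv evw uw dv dw; have uv := edge_neq euv; have vw := edge_neq evw.
have ewv : e w v by rewrite esym.
have wv : w != v by rewrite eq_sym.
have wu : w != u by rewrite eq_sym.
pose e2 := del e (pair_rel w v).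
have e2s : symmetric e2 by exact/del_sym/pair_rel_sym.
have e2uv : e2 u v by rewrite /e2 /del euv /pair_rel (negbTE uw) (negbTE uv).
have e2vu : e2 v u by rewrite e2s.
pose e1 := del e2 (pair_rel u v).
have ds : symmetric e1 by exact/del_sym/pair_rel_sym.
have [||C [pC sC satC]] := IH (e' := e1) ds.
- by move=> x y /andP[/andP[]].
- by exists u, v; rewrite euv /e1 /del /pair_rel !eqxx !andbF.
have uD := hdeg u.
have du1 : deg e1 u + 1 = deg e u.
  by rewrite (deg_pair_l e2uv uv) /e2 deg_pair_o.
have dv0 : deg e1 v = 0.
  by have := deg_pair_r e2vu uv; have := deg_pair_r evw wv; rewrite -/e2 -/e1 dv; clear; lia.
have dw1 : deg e1 w + 1 = deg e w.
  by rewrite /e1 deg_pair_o //; exact: (deg_pair_l ewv wv).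
have [a [b [au bu ab left]]] : exists a b, [/\ a \in free_out C u, b \in free_in C u, a != b &
    #|free_out C u :\ a| <= 1 -> (free_out C u :\ a) :&: (free_in C u :\ b) = set0].
  apply: pick_leaf; [by rewrite (card_free_out u pC sC); move: du1 uD; clear; lia | | exact: satC].
  exact: card_free_out_free_in ds pC sC.
have av : a \in free_in C v by rewrite (full_free_in ds pC sC dv0) inE.
have bv : b \in free_out C v by rewrite (full_free_out pC sC dv0) inE.
have [p [q [pw qw pq leftw]]] : exists p q, [/\ p \in free_out C w :\ a, q \in free_in C w :\ b,
    p != q & #|free_out C w :\ p| <= 1 -> (free_out C w :\ p) :&: (free_in C w :\ q) = set0].
  case: dw => [dw|[DE dw euw]].
    have cw : 2 < #|free_out C w| by rewrite (card_free_out w pC sC); move: dw dw1; clear; lia.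
    have cw' : 2 < #|free_in C w| by rewrite (card_free_out_free_in w ds pC sC).
    have [p [q [h1 h2 h3]]] := pick_free a b cw cw'; exists p, q; split=> //.
    by have := @card_setD1_le _ (free_out C w) p 2 cw; clear; lia.
  have cw : #|free_out C w| = 2 by rewrite (card_free_out w pC sC); move: dw dw1 DE; clear; lia.
  have cw' : #|free_in C w| = 2 by rewrite (card_free_out_free_in w ds pC sC).
  case: (pick_two cw cw' ab) => [[c [SE UE ac bc]]|[p [q [h1 h2 h3 h4]]]]; last first.
    by exists p, q; split.
  (* The colours of both arcs between u and w avoid a, b and c, hence agree. *)
  exfalso; have e1uw : e1 u w.
    by rewrite /e1 /e2 /del euw /pair_rel (negbTE uw) (negbTE uv) (negbTE wv) !andbF.
  have [r hr] : exists r, C u w r by apply/existsP; rewrite -sC.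
  have [s hs] : exists s, C w u s by apply/existsP; rewrite -sC ds.
  have [ra rb rc] : [/\ r != a, r != b & r != c].
    split; first by apply: contraTneq hr => ->; apply: (free_outP _ _ _ au).
      by apply: contraTneq hr => ->; apply: (free_inP C w b _); rewrite UE !inE eqxx.
    by apply: contraTneq hr => ->; apply: (free_inP C w c _); rewrite UE !inE eqxx orbT.
  have [sa sb sc] : [/\ s != a, s != b & s != c].
    split; first by apply: contraTneq hs => ->; apply: (free_outP C w a _); rewrite SE !inE eqxx.
      by apply: contraTneq hs => ->; apply: (free_inP _ _ _ bu).
    by apply: contraTneq hs => ->; apply: (free_outP C w c _); rewrite SE !inE eqxx orbT.
  have rs : r != s.
    apply: contraTneq hs => <-; case: pC => _ _ p3 _ _; exact: p3.
  have : uniq [:: r; s; a; b; c].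
    by rewrite /= !inE !negb_or rs ra rb rc sa sb sc ab ac bc.
  move=> /card_uniqP h; have := max_card (mem [:: r; s; a; b; c]).
  by rewrite h card_ord /= DE.
have nC k := del_pair_uncolored k sC.
pose C1 := add C u v a b.
have pC1 : proper C1 by apply: add_proper => // k; case: (nC k).
have sC1 : supports e2 C1.
  exact: supports_union (pair_sub e2s e2uv) sC (edge_supports _ _ _ _).
have nC1 k := del_pair_uncolored k sC1.
have [pw1 pw2] : p != a /\ p \in free_out C w by move: pw; rewrite !inE => /andP[].
have [qw1 qw2] : q != b /\ q \in free_in C w by move: qw; rewrite !inE => /andP[].
have fw : free_out C1 w = free_out C w by apply: add_free_out_o.
have gw : free_in C1 w = free_in C w by apply: add_free_in_o.
have pC2 : proper (add C1 w v p q).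
  apply: add_proper => //; try by move=> k; case: (nC1 k).
  - by rewrite fw.
  - by rewrite /C1 add_free_in_r // in_setD1 pw1 (full_free_in ds pC sC dv0) inE.
  - by rewrite gw.
  - by rewrite /C1 add_free_out_r // in_setD1 qw1 (full_free_out pC sC dv0) inE.
have sC2 : supports e (add C1 w v p q).
  exact: supports_union (pair_sub esym ewv) sC1 (edge_supports _ _ _ _).
exists (add C1 w v p q); split=> // z.
have [->|zw] := eqVneq z w.
  by rewrite add_free_out_l // add_free_in_l // fw gw.
have [->|zv] := eqVneq z v; first by apply: saturated_low pC2 sC2 _; rewrite dv.
rewrite add_free_out_o // add_free_in_o //.
have [->|zu] := eqVneq z u; first by rewrite add_free_out_l // add_free_in_l.
by rewrite add_free_out_o // add_free_in_o //; exact: satC.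
Qed.

End Reductions.

(** * Chains of triangles by exhaustive search *)

Definition nbrs (arcs : seq (nat * nat)) i := [seq p.2 | p <- arcs & p.1 == i].

Definition both_ways (s : seq (nat * nat)) :=
  flatten [seq [:: p; (p.2, p.1)] | p <- s].

(** This is [bounds] with [u] in position 0 and [x] in the last one, freed from the vertex type so
    that it can be evaluated. *)
Definition end_bounds D m (A B : seq nat) :=
  [seq if i == 0 then A else if i == m.-1 then B else iota 0 D | i <- iota 0 m].

Definition extendable D m arcs n cov :=
  all (fun iu => all (fun ox => all (fun ix =>
    isSome (solve D m arcs [:: 0; m.-1] cov
      (end_bounds D m (iota 0 n) ox) (end_bounds D m iu ix) arcs [::]))
  (choices n D)) (choices n D)) (choices n D).

(* The order of the edges only matters for the speed of the search. *)
Definition two_ears_edges := [:: (0, 2); (0, 1); (2, 4); (3, 4); (1, 2); (2, 3)].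
Definition closed_ears_edges :=
  [:: (0, 1); (0, 2); (0, 4); (2, 4); (3, 4); (1, 2); (2, 3)].
Definition three_ears_edges :=
  [:: (0, 1); (0, 2); (4, 6); (5, 6); (2, 4); (1, 2); (2, 3); (3, 4); (4, 5)].

(** Inner vertices of degree 4 sit at position 2 and, in the longest chain, also at position 4. For
    [D = 5] their degree is [D - 1], so position 2 is listed in [cov]; for [D = 4] such a vertex
    uses all colours anyway. In the closed chain the chord between the ends raises the reserved
    number from 2 to 3. *)
Lemma two_ears_extendable : extendable 5 5 (both_ways two_ears_edges) 2 [:: 2].
Proof. by vm_compute. Qed.

Lemma closed_ears_extendable : extendable 4 5 (both_ways closed_ears_edges) 3 [::].
Proof. by vm_compute. Qed.

Lemma three_ears_extendable : extendable 4 7 (both_ways three_ears_edges) 2 [::].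
Proof. by vm_compute. Qed.

Section EarReductions.
Variables (V : finType) (D : nat) (e : rel V).
Hypothesis esym : symmetric e.
Hypothesis hdeg : forall u, deg e u <= D.
Hypothesis IH : forall e' : rel V, symmetric e' -> subrel e' e ->
  (exists a b, e a b && ~~ e' a b) -> colorable D e'.

(** Concrete indices turn the hypotheses of [local_reduction] into computations on a list of edges;
    [u] and the last vertex are the ends. Comparing [size (nbrs arcs i)] with the degree shows that
    an inner vertex has no edge outside the configuration. *)
Lemma ears_reduction (u y : V) (vs : seq V) edges n cov :
  let all_vs := [:: u, y & vs] in let arcs := both_ways edges in let m := size all_vs in
  uniq all_vs -> 1 < n ->
  all (fun p => [&& p.1 < m, p.2 < m & e (nth u all_vs p.1) (nth u all_vs p.2)]) edges ->
  all (fun i => uniq (nbrs arcs i)) (iota 0 m) ->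
  size (nbrs arcs 0) = n -> size (nbrs arcs m.-1) = n ->
  all (fun i => let v := nth u all_vs i in (size (nbrs arcs i) == deg e v) &&
    [|| deg e v + 2 <= D, deg e v == D | i \in cov]) (iota 1 m.-2) ->
  extendable D m arcs n cov -> colorable D e.
Proof.
move=> all_vs arcs m uvs n1 /allP wf /allP unb s0 sl /allP inn /allP ext.
set P := local_rel all_vs arcs.
have arcs_sym p : p \in arcs -> (p.2, p.1) \in arcs.
  move=> /flatten_mapP[q hq]; rewrite !inE => h; apply/flatten_mapP; exists q => //.
  by rewrite !inE; case/orP: h => /eqP->; rewrite -?surjective_pairing eqxx ?orbT.
have wf' p : p \in arcs -> [&& p.1 < m, p.2 < m & e (nth u all_vs p.1) (nth u all_vs p.2)].
  move=> /flatten_mapP[q /wf/and3P[h1 h2 h3]]; rewrite !inE => /orP[] /eqP->.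
    by rewrite h1 h2.
  by rewrite /= h1 h2 esym.
have Ps : symmetric P by move=> a b; apply/idP/idP => /arcs_sym.
have sub_e : subrel P e.
  move=> a b /wf'/and3P[h1 h2 h3].
  have ha : a \in all_vs by rewrite -index_mem.
  have hb : b \in all_vs by rewrite -index_mem.
  have : e (nth u all_vs (index a all_vs)) (nth u all_vs (index b all_vs)) by [].
  by rewrite !nth_index.
have degE v : v \in all_vs -> deg (del e P) v + size (nbrs arcs (index v all_vs)) = deg e v.
  move=> vv; rewrite -(size_map (nth u all_vs)); apply: deg_del.
    rewrite map_inj_in_uniq; first by apply: unb; rewrite mem_iota leq0n add0n index_mem.
    move=> i j /mapP[p + ->] /mapP[q + ->]; rewrite !mem_filter.
    move=> /andP[_ /wf'/and3P[_ h1 _]] /andP[_ /wf'/and3P[_ h2 _]] /eqP.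
    by rewrite nth_uniq // => /eqP.
  move=> z; apply/andP/mapP => [[_ h]|[j /mapP[p]]].
    exists (index z all_vs); last by rewrite nth_index // -index_mem; case/and3P: (wf' _ h).
    by apply/mapP; exists (index v all_vs, index z all_vs); rewrite ?mem_filter ?eqxx.
  rewrite mem_filter => /andP[/eqP p1 pa] -> ->.
  have /and3P[_ h _] := wf' _ pa.
  suff h' : P v (nth u all_vs p.2) by split=> //; exact: sub_e.
  by rewrite /P /local_rel index_uniq // -p1 -surjective_pairing.
pose x := last y vs.
have iu : index u all_vs = 0 by rewrite /= eqxx.
have ix : index x all_vs = m.-1.
  have -> : x = nth u all_vs m.-1 by rewrite /x /= -[RHS]/(nth u (y :: vs) (size vs)) -last_nth.
  by rewrite index_uniq.
have xin : x \in all_vs by rewrite inE mem_last orbT.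
apply: (@local_reduction V D e esym all_vs arcs uvs n u x n1 _ _ xin cov).
- apply/eqP => ux; have := ix; rewrite -ux iu //.
- by rewrite mem_head.
- move=> iu' ox ix' h1 h2 h3.
  have := allP (allP (ext iu' h1) ox h2) ix' h3 => /solve_valid [l vl]; exists l.
  by rewrite /bounds iu ix.
- exact: sub_e.
- move=> v vv vu vx; have i0 : 0 < index v all_vs.
    by rewrite lt0n -iu; apply: contra vu => /eqP h; rewrite -(nth_index u vv) h iu.
  have im : index v all_vs != m.-1.
    by apply: contra vx => /eqP h; rewrite -(nth_index u vv) h -ix nth_index.
  have := inn (index v all_vs); rewrite mem_iota nth_index //.
  have -> : 0 < index v all_vs < 1 + m.-2.
    by have := vv; rewrite -index_mem -/m; move: i0 im; rewrite /m /=; clear; lia.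
  move=> /(_ isT)/andP[/eqP h1 h2]; split=> //.
  by apply/eqP; rewrite -(eqn_add2r (deg e v)) -{1}h1 (degE v vv).
- by rewrite -s0 -(degE u (mem_head _ _)) iu.
- exact: hdeg.
- by rewrite -sl -(degE x xin) ix.
- exact: hdeg.
apply: IH.
- exact: del_sym.
- exact: del_sub.
have [p pa] : exists p, p \in arcs.
  by case: (arcs) s0 n1 => [|p r] /=; [move=> <- | exists p; rewrite mem_head].
have /and3P[h1 h2 h3] := wf' _ pa.
exists (nth u all_vs p.1), (nth u all_vs p.2); rewrite h3 /del h3 /= negbK.
by rewrite /P /local_rel !index_uniq // -surjective_pairing.
Qed.

Lemma two_ears_reduction u s w t x : D = 5 -> two_ears e u s w t x -> colorable D e.
Proof.
move=> D5 /and3P[un /and5P[us sw uw wt /andP[tx wx]] /and3P[/eqP ds /eqP dt /eqP dw]].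
apply: (@ears_reduction u s [:: w; t; x] two_ears_edges 2 [:: 2]) => //=.
- by rewrite uw us wx tx sw wt.
- by rewrite ds dt dw D5.
- by rewrite D5; exact: two_ears_extendable.
Qed.

Lemma closed_ears_reduction u s w t x : D = 4 -> two_ears e u s w t x -> e u x ->
  colorable D e.
Proof.
move=> DE /and3P[un /and5P[us sw uw wt /andP[tx wx]] /and3P[/eqP ds /eqP dt /eqP dw]] ux.
apply: (@ears_reduction u s [:: w; t; x]
  closed_ears_edges 3 [::]) => //=.
- by rewrite uw us wx tx sw wt ux.
- by rewrite ds dt dw DE.
- by rewrite DE; exact: closed_ears_extendable.
Qed.

Lemma three_ears_reduction u s w t x r y : D = 4 -> two_ears e u s w t x ->
  third_ear e u s w t x r y -> colorable D e.
Proof.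
move=> DE /and3P[_ /and5P[us sw uw wt /andP[tx wx]] /and3P[/eqP ds /eqP dt /eqP dw]].
move=> /and3P[un /and3P[xr ry xy] /andP[/eqP dr /eqP dx]].
apply: (@ears_reduction u s [:: w; t; x; r; y]
  three_ears_edges 2 [::]) => //=.
- by rewrite uw us wx tx sw wt xr ry xy.
- by rewrite ds dt dw dr dx DE.
- by rewrite DE; exact: three_ears_extendable.
Qed.

End EarReductions.

(** Induction on the number of arcs; the same [t] serves every subgraph. *)
Theorem even_tournament_colorable (V : finType) (D : nat) (e t : rel V) :
  4 <= D -> symmetric e -> irreflexive e -> even_tournament e t ->
  (forall u, deg e u <= D) -> colorable D e.
Proof.
move=> D4; have [n] := ubnP #|[set p : V * V | e p.1 p.2]|.
elim: n e => // n IHn e en es ei ev hdeg.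
have IH (e' : rel V) : symmetric e' -> subrel e' e ->
    (exists a b, e a b && ~~ e' a b) -> colorable D e'.
  move=> es' sub [a [b /andP[eab neab]]]; apply: IHn => //.
  - rewrite -ltnS (leq_trans _ en) // ltnS; apply: proper_card; apply/properP; split.
      by apply/subsetP => p; rewrite !inE; exact: sub.
    by exists (a, b); rewrite !inE.
  - by move=> u; apply: contraFF (ei u); exact: sub.
  - case: ev => [tA tE]; split=> // a' b' c' d' /sub h1 /sub h2; exact: tE.
  - move=> u; apply: leq_trans (hdeg u); apply: subset_leq_card.
    by apply/subsetP => v; rewrite !inE; exact: sub.
have [/existsP[v /eqP dv]|/existsPn deg1] := boolP [exists v, deg e v == 1].
  have [u] : exists u, u \in [set u | e v u] by apply/card_gt0P; rewrite -/(deg e v) dv.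
  by rewrite inE es => euv; exact: (leaf_reduction es ei D4 hdeg IH euv dv).
have [/existsP h|/existsPn deg0] := boolP [exists u, 0 < deg e u]; last first.
  exists (fun _ _ _ => false); split.
  - by split.
  - move=> u v; rewrite [RHS](introF existsP); last by case.
    apply: contraNF (deg0 u) => euv; apply/card_gt0P; exists v; by rewrite inE.
  - move=> u; have -> : free_out (fun _ _ (_ : 'I_D) => false) u = setT.
      by apply/setP => k; rewrite [RHS]inE; apply/free_outP.
    by rewrite cardsT card_ord => h; move: (leq_trans D4 h).
case: (even_tournament_reducible es ei ev h deg1).
- by move=> [x [y [exy dx dy]]]; exact: (edge_reduction es ei D4 IH exy dx dy).
- move=> [u [v [w [uv vw uw dv dw]]]].
  have nuw := edge_neq ei uw.
  apply: (ear_reduction es ei D4 hdeg IH uv vw nuw dv); rewrite dw.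
  have [D5|] := leqP 5 D; [by left | by move=> D5; right; split=> //; lia].
move=> [u [s [w [v [x [te alt]]]]]].
(* In a chain [w] has degree 4, which is at most [D - 2] here, so its first triangle can be removed
   alone. *)
have [D6|D5] := leqP 6 D.
  case/and3P: te => un /and5P[us sw uw _ _] /and3P[/eqP ds _ /eqP dw].
  apply: (ear_reduction es ei D4 hdeg IH us sw (edge_neq ei uw) ds); left.
  by rewrite dw.
have [D5'|nD5] := eqVneq D 5; first exact: (two_ears_reduction es hdeg IH D5' te).
have D4' : D = 4 by lia.
case: alt => [ux|[r [y tr]]]; first exact: (closed_ears_reduction es hdeg IH D4' te ux).
exact: (three_ears_reduction es hdeg IH D4' te tr).
Qed.

(** * Polygonal lines in the plane *)

From mathcomp Require Import all_classical all_reals all_analysis.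
From mathcomp Require Import ssrAC lra ring.

Import Order.TTheory GRing.Theory Num.Theory.
Import numFieldNormedType.Exports.

Local Open Scope classical_set_scope.
Local Open Scope ring_scope.

Section Segments.
Variable R : realFieldType.
Local Notation point := (R * R)%type.
Implicit Types (a b c d p q : point) (s t : R) (l m : seq point).

Definition segpt s a b : point :=
  ((1 - s) * a.1 + s * b.1, (1 - s) * a.2 + s * b.2).

Definition segdisj a b c d := forall s t, 0 <= s <= 1 -> 0 <= t <= 1 ->
  segpt s a b <> segpt t c d.

Lemma segpt0 a b : segpt 0 a b = a.
Proof. by case: a => x y; rewrite /segpt /=; congr pair; ring. Qed.

Lemma segpt1 a b : segpt 1 a b = b.
Proof. by case: b => x y; rewrite /segpt /=; congr pair; ring. Qed.

Fixpoint segs a l : seq (point * point) :=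
  if l is b :: l' then (a, b) :: segs b l' else [::].

Lemma segs_mem a l z : z \in segs a l -> (z.1 \in a :: l) && (z.2 \in a :: l).
Proof.
elim: l a => [|b l IH] a //=; rewrite inE => /orP[/eqP->|/IH /andP[h1 h2]].
  by rewrite /= !inE !eqxx orbT.
by rewrite inE h1 orbT inE h2 orbT.
Qed.

Lemma mem_segs a l p : l != [::] -> p \in a :: l ->
  exists2 z, z \in segs a l & p = z.1 \/ p = z.2.
Proof.
elim: l a => [|b l IH] a // _; rewrite inE => /orP[/eqP->|pl].
  by exists (a, b); rewrite ?mem_head //; left.
case: l IH pl => [|b' l] IH pl.
  exists (a, b); rewrite ?mem_head //; right.
  by move: pl; rewrite inE => /eqP.
have [z zl h] := IH b isT pl.
by exists z => //=; rewrite inE -/(segs b (b' :: l)) zl orbT.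
Qed.

Lemma telescope_segs (g : point -> bool) a l :
  \big[addb/false]_(z <- segs a l) (g z.1 (+) g z.2) = g a (+) g (last a l).
Proof.
elim: l a => [|b l IH] a /=; first by rewrite big_nil addbb.
by rewrite big_cons IH /= addbA addbK.
Qed.

Definition polydisj a l c m :=
  forall z z', z \in segs a l -> z' \in segs c m -> segdisj z.1 z.2 z'.1 z'.2.

Lemma polydisj_neq a l c m p q : l != [::] -> m != [::] -> polydisj a l c m ->
  p \in a :: l -> q \in c :: m -> p <> q.
Proof.
move=> l0 m0 dis /(mem_segs l0)[z zl hz] /(mem_segs m0)[z' zl' hz'] pq.
have {}dis := dis _ _ zl zl'.
have [s s01 ps] : exists2 s, 0 <= s <= 1 & p = segpt s z.1 z.2.
  case: hz => ->; [exists 0|exists 1]; rewrite ?segpt0 ?segpt1 //; lra.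
have [t t01 qt] : exists2 s, 0 <= s <= 1 & q = segpt s z'.1 z'.2.
  case: hz' => ->; [exists 0|exists 1]; rewrite ?segpt0 ?segpt1 //; lra.
by apply: (dis s t) => //; rewrite -ps -qt.
Qed.

(* After the shear [absc] the vertical direction is generic, so that finitely many
   distinct points have distinct abscissas. *)
Variable tau : R.
Definition absc p := p.1 + tau * p.2.

Definition between a b c := (absc a < absc c) (+) (absc b < absc c).

Definition orient a b c := (absc b - absc a) * (c.2 - a.2) - (b.2 - a.2) * (absc c - absc a).

(** [orient] is the cross product in the coordinates [absc] and height. The factor [absc a - absc b]
    makes the test independent of the direction of the segment and avoids a division. *)
Definition above a b c := between a b c && (0 < (absc a - absc b) * orient a b c).
Definition below a b c := between a b c && (0 < (absc b - absc a) * orient a b c).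

Lemma absc_segpt s a b : absc (segpt s a b) = (1 - s) * absc a + s * absc b.
Proof. rewrite /absc /=; ring. Qed.

Lemma segpt_comb r s s' a b :
  segpt r (segpt s a b) (segpt s' a b) = segpt ((1 - r) * s + r * s') a b.
Proof. by rewrite /segpt /=; congr pair; ring. Qed.

(** If the order were reversed, moving along both segments in the same ratio would keep the
    abscissas equal and make the heights agree at the ratio [r], a common point. *)
Lemma segdisj_height a b c d s t s' t' : segdisj a b c d ->
  0 <= s <= 1 -> 0 <= t <= 1 -> 0 <= s' <= 1 -> 0 <= t' <= 1 ->
  absc (segpt s a b) = absc (segpt t c d) -> absc (segpt s' a b) = absc (segpt t' c d) ->
  (segpt t c d).2 < (segpt s a b).2 -> (segpt t' c d).2 < (segpt s' a b).2.
Proof.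
move=> dis s1 t1 s'1 t'1 e e' h; rewrite ltNge; apply/negP => h'.
set P := segpt s a b in e h *; set P' := segpt t c d in e h *.
set Q := segpt s' a b in e' h' *; set Q' := segpt t' c d in e' h' *.
pose den := (P.2 - P'.2) + (Q'.2 - Q.2).
have den0 : 0 < den by rewrite /den; lra.
pose r := (P.2 - P'.2) / den.
have r0 : 0 <= r by rewrite /r divr_ge0 //; lra.
have r1 : r <= 1 by rewrite /r ler_pdivrMr // mul1r /den; lra.
have rden : r * den = P.2 - P'.2 by rewrite /r divfK // gt_eqF.
apply: (dis ((1 - r) * s + r * s') ((1 - r) * t + r * t')).
- by case/andP: s1; case/andP: s'1; move=> *; apply/andP; split; nra.
- by case/andP: t1; case/andP: t'1; move=> *; apply/andP; split; nra.
rewrite -!segpt_comb -/P -/Q -/P' -/Q'.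
have e2 : (segpt r P Q).2 = (segpt r P' Q').2.
  have lin (x x' y y' : R) : r * ((x - x') + (y' - y)) = x - x' ->
      (1 - r) * x + r * y = (1 - r) * x' + r * y' by move=> k; lra.
  exact: lin rden.
have e1 : absc (segpt r P Q) = absc (segpt r P' Q').
  by rewrite (absc_segpt r P) (absc_segpt r P') e e'.
rewrite [LHS]surjective_pairing [RHS]surjective_pairing e2; congr pair.
by move: e1; rewrite /absc e2; lra.
Qed.

Lemma betweenP a b c : absc a != absc c -> absc b != absc c -> between a b c ->
  exists2 s, 0 <= s <= 1 & [/\ absc (segpt s a b) = absc c,
    above a b c = (c.2 < (segpt s a b).2) & below a b c = ((segpt s a b).2 < c.2)].
Proof.
move=> ac bc bt.
have ab : absc b - absc a != 0.
  rewrite subr_eq0; apply: contraTneq bt => eab.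
  by rewrite /between eab addbb.
pose s := (absc c - absc a) / (absc b - absc a).
have se : s * (absc b - absc a) = absc c - absc a by rewrite /s divfK.
have hX : absc (segpt s a b) = absc c by rewrite absc_segpt; nra.
have s01 : 0 <= s <= 1.
  have: 0 <= s /\ 0 <= 1 - s.
    case: (ltrgtP (absc a) (absc b)) ab => [ltab|ltab|->]; last by rewrite subrr eqxx.
      move=> _; have : absc a < absc c < absc b.
        move: bt; rewrite /between; case: ltgtP ac => // ? _; case: ltgtP bc => //= ? _; lra.
      by move=> h; split; rewrite -(pmulr_lge0 _ (_ : 0 < absc b - absc a)); lra.
    move=> _; have : absc b < absc c < absc a.
      move: bt; rewrite /between; case: ltgtP ac => // ? _; case: ltgtP bc => //= ? _; lra.
    by move=> h; split; rewrite -(nmulr_lle0 _ (_ : absc b - absc a < 0)); lra.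
  by case=> ? ?; lra.
exists s => //; split=> //.
- have -> : above a b c = (0 < (absc b - absc a) ^+ 2 * ((segpt s a b).2 - c.2)).
    rewrite /above bt /=; congr (_ < _); rewrite /orient -se /segpt /=; ring.
  by rewrite pmulr_rgt0 ?subr_gt0 // exprn_even_gt0.
- have -> : below a b c = (0 < (absc b - absc a) ^+ 2 * (c.2 - (segpt s a b).2)).
    rewrite /below bt /=; congr (_ < _); rewrite /orient -se /segpt /=; ring.
  by rewrite pmulr_rgt0 ?subr_gt0 // exprn_even_gt0.
Qed.

Lemma above_addb_below a b c : absc a != absc c -> absc b != absc c ->
  (forall s, 0 <= s <= 1 -> segpt s a b <> c) ->
  above a b c (+) below a b c = between a b c.
Proof.
move=> ac bc off; have [bt|nbt] := boolP (between a b c); last first.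
  by rewrite /above /below (negbTE nbt).
have [s s01 [Xs -> ->]] := betweenP ac bc bt.
case: (ltgtP c.2) => // e; case: (off _ s01).
rewrite [LHS]surjective_pairing [RHS]surjective_pairing e; congr pair.
by move: Xs; rewrite /absc e; lra.
Qed.

(** Wherever both segments lie over the same abscissa, the same one is on top; [h] records which.
    Each of the four terms is a [between] restricted by [h], and the four [between] compare every
    end of one segment with every end of the other in both directions, an even total. *)
Lemma segdisj_even a b c d : segdisj a b c d ->
  absc a != absc c -> absc a != absc d -> absc b != absc c -> absc b != absc d ->
  above a b c (+) above a b d (+) (below c d a (+) below c d b) = false.
Proof.
move=> dis ac ad bc bd.
pose h := `[< exists s t, [/\ 0 <= s <= 1, 0 <= t <= 1,
  absc (segpt s a b) = absc (segpt t c d) & (segpt t c d).2 < (segpt s a b).2] >].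
have hE s t : 0 <= s <= 1 -> 0 <= t <= 1 -> absc (segpt s a b) = absc (segpt t c d) ->
    ((segpt t c d).2 < (segpt s a b).2) = h.
  move=> s1 t1 e; apply/idP/idP => [k|]; first by apply/asboolP; exists s, t.
  by case/asboolP => s' [t' [? ? ? ?]]; apply: (@segdisj_height a b c d s' t').
have b0 : 0 <= (0 : R) <= 1 by lra.
have b1 : 0 <= (1 : R) <= 1 by lra.
have E1 : above a b c = between a b c && h.
  have [bt|nbt] := boolP (between a b c); last by rewrite /above (negbTE nbt).
  have [s s01 [Xs -> _]] := betweenP ac bc bt.
  by rewrite -[in c.2](segpt0 c d) (hE s 0) // segpt0.
have E2 : above a b d = between a b d && h.
  have [bt|nbt] := boolP (between a b d); last by rewrite /above (negbTE nbt).
  have [s s01 [Xs -> _]] := betweenP ad bd bt.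
  by rewrite -[in d.2](segpt1 c d) (hE s 1) // segpt1.
have E3 : below c d a = between c d a && h.
  have [bt|nbt] := boolP (between c d a); last by rewrite /below (negbTE nbt).
  have [|| s s01 [Xs _ ->]] := betweenP _ _ bt; rewrite 1?eq_sym //.
  by rewrite -[in a.2](segpt0 a b) (hE 0 s) // segpt0.
have E4 : below c d b = between c d b && h.
  have [bt|nbt] := boolP (between c d b); last by rewrite /below (negbTE nbt).
  have [|| s s01 [Xs _ ->]] := betweenP _ _ bt; rewrite 1?eq_sym //.
  by rewrite -[in b.2](segpt1 a b) (hE 1 s) // segpt1.
rewrite E1 E2 E3 E4; case: h {hE E1 E2 E3 E4}; rewrite ?andbT ?andbF //.
rewrite /between.
by case: (ltgtP (absc a) (absc c)) ac; case: (ltgtP (absc a) (absc d)) ad;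
  case: (ltgtP (absc b) (absc c)) bc; case: (ltgtP (absc b) (absc d)) bd.
Qed.

Definition up a l c := \big[addb/false]_(z <- segs a l) above z.1 z.2 c.
Definition dn a l c := \big[addb/false]_(z <- segs a l) below z.1 z.2 c.

(** Sum [segdisj_even] over all pairs of segments; the contributions of interior vertices cancel by
    [telescope_segs]. *)
Lemma polydisj_even a l c m : polydisj a l c m ->
  (forall p q, p \in a :: l -> q \in c :: m -> absc p != absc q) ->
  up a l c (+) up a l (last c m) (+) (dn c m a (+) dn c m (last a l)) = false.
Proof.
move=> dis Xn; rewrite /up /dn -!big_split /=.
under eq_bigr => z _ do rewrite -telescope_segs.
under [X in _ (+) X]eq_bigr => z _ do rewrite -telescope_segs.
rewrite [X in _ (+) X]exchange_big -big_split /=.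
rewrite big_seq; apply: big1 => z zl.
rewrite -big_split /= big_seq; apply: big1 => z' zm.
have /andP[z1 z2] := segs_mem zl; have /andP[z1' z2'] := segs_mem zm.
by apply: segdisj_even; [exact: dis | exact: Xn..].
Qed.

(** The vertical line through [c] crosses the polygonal line with the parity given by the sides on
    which its ends lie, and each crossing is above or below [c]. *)
Lemma up_addb_dn a l c : (forall p, p \in a :: l -> absc p != absc c) ->
  (forall z, z \in segs a l -> forall s, 0 <= s <= 1 -> segpt s z.1 z.2 <> c) ->
  up a l c (+) dn a l c = (absc a < absc c) (+) (absc (last a l) < absc c).
Proof.
move=> Xn off; rewrite /up /dn -big_split /= -(telescope_segs (fun p => absc p < absc c)).
rewrite big_seq [RHS]big_seq; apply: eq_bigr => z zl.
have /andP[z1 z2] := segs_mem zl.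
by apply: above_addb_below; [exact: Xn | exact: Xn | exact: off].
Qed.

(* A point beyond the line [al * x + be * y = const] sees either no segment
   above it, or all of those that are vertically aligned with it. *)
Lemma up_far a l q al be :
  (forall p, p \in a :: l -> al * p.1 + be * p.2 < al * q.1 + be * q.2) ->
  (forall p, p \in a :: l -> absc p != absc q) ->
  up a l q = ((be - al * tau < 0) && (absc a < absc q)) (+)
             ((be - al * tau < 0) && (absc (last a l) < absc q)).
Proof.
move=> far Xn.
rewrite /up -(telescope_segs (fun p => (be - al * tau < 0) && (absc p < absc q))).
rewrite big_seq [RHS]big_seq; apply: eq_bigr => z zl.
have /andP[z1 z2] := segs_mem zl.
have [bt|nbt] := boolP (between z.1 z.2 q); last first.
  rewrite /above (negbTE nbt) /=; move: nbt; rewrite /between.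
  by case: (_ < 0); case: (_ < _); case: (_ < _).
have [s s01 [Xs -> _]] := betweenP (Xn _ z1) (Xn _ z2) bt.
have -> : (q.2 < (segpt s z.1 z.2).2) = (be - al * tau < 0); last first.
  by move: bt; rewrite /between; case: (_ < 0); case: (_ < _); case: (_ < _).
set w := segpt s z.1 z.2 in Xs *.
have fw : al * w.1 + be * w.2 < al * q.1 + be * q.2.
  have := far _ z1; have := far _ z2; move: s01 => /andP[s0 s1]; rewrite /w /segpt /=.
  move=> h2 h1; case: (ltrP 0 s) => sp; last by have -> : s = 0; [lra|]; lra.
  by nra.
have : (be - al * tau) * (w.2 - q.2) < 0 by move: Xs fw; rewrite /absc; nra.
by move=> h; apply/idP/idP => k; nra.
Qed.

End Segments.

Lemma seq_ub (R : realFieldType) (s : seq R) : exists M, forall x, x \in s -> x < M.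
Proof.
elim: s => [|y s [M IH]]; first by exists 0.
exists (Num.max M (y + 1)) => x; rewrite inE lt_max => /orP[/eqP->|/IH-> //].
by apply/orP; right; lra.
Qed.

(** Two points at different heights collide for the single value [(q.1 - p.1) / (p.2 - q.2)] of
    [tau], so any [tau] above all of these works. *)
Lemma generic_shear (R : realFieldType) (S : seq (R * R)) :
  exists tau, forall p q, p \in S -> q \in S -> p <> q -> absc tau p != absc tau q.
Proof.
have [M hM] := seq_ub [seq (q.1 - p.1) / (p.2 - q.2) | p <- S, q <- S].
exists M => p q pS qS npq; apply/eqP => eX; apply: npq.
have e12 : M * (p.2 - q.2) = q.1 - p.1 by move: eX; rewrite /absc; lra.
have [e2|ne2] := eqVneq p.2 q.2.
  rewrite [p]surjective_pairing [q]surjective_pairing e2; congr pair.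
  by move: e12; rewrite e2 subrr mulr0; lra.
have := hM _ (allpairs_f (fun p q => (q.1 - p.1) / (p.2 - q.2)) pS qS).
by rewrite -e12 mulfK ?ltxx // subr_eq0.
Qed.

(** By [polydisj_even] for an edge [u w] and the line from [v], the parity of the segments of the
    edge above [v] splits as [pot v u (+) pot v w]. Here [pot v u] counts the segments of the line
    from [v] below [u], corrected by the contribution of its far end, which [up_far] computes. *)
Lemma polygonal_even_tournament (R : realFieldType) (V : finType) (e : rel V)
    (pos : V -> R * R) (st : V -> V -> R * R) (L : V -> V -> seq (R * R))
    (C : V -> seq (R * R)) (al be : V -> R) :
  injective pos ->
  (forall u v, e u v -> L u v != [::]) ->
  (forall u v, e u v ->
    st u v = pos u /\ last (st u v) (L u v) = pos v \/
    st u v = pos v /\ last (st u v) (L u v) = pos u) ->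
  (forall v, C v != [::]) ->
  (forall u v w z, e u v -> e w z -> u != w -> u != z -> v != w -> v != z ->
    polydisj (st u v) (L u v) (st w z) (L w z)) ->
  (forall u w v, e u w -> v != u -> v != w ->
    polydisj (st u w) (L u w) (pos v) (C v)) ->
  (forall v u w p, e u w -> p \in st u w :: L u w ->
    al v * p.1 + be v * p.2 <
    al v * (last (pos v) (C v)).1 + be v * (last (pos v) (C v)).2) ->
  exists t, even_tournament e t.
Proof.
move=> posI L0 Lend C0 Ldis Cdis far.
pose S := flatten [seq st z.1 z.2 :: L z.1 z.2 | z <- enum {: V * V}] ++
          flatten [seq pos v :: C v | v <- enum V].
have [tau Xn] := generic_shear S.
have SL u v p : p \in st u v :: L u v -> p \in S.
  move=> h; rewrite mem_cat; apply/orP; left; apply/flattenP.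
  exists (st u v :: L u v) => //; apply/mapP; exists (u, v) => //.
  by rewrite mem_enum.
have SC v p : p \in pos v :: C v -> p \in S.
  move=> h; rewrite mem_cat; apply/orP; right; apply/flattenP.
  by exists (pos v :: C v) => //; apply/mapP; exists v; rewrite ?mem_enum.
have Spos v : pos v \in S by apply: (SC v); rewrite mem_head.
pose x v := absc tau (pos v).
pose q v := last (pos v) (C v).
pose sgn v := be v - al v * tau < 0.
pose pot v u := dn tau (pos v) (C v) (pos u) (+) (sgn v && (x u < absc tau (q v))).
have upE u w v : e u w -> v != u -> v != w ->
    up tau (st u w) (L u w) (pos v) = pot v u (+) pot v w.
  move=> euw vu vw.
  have dis := Cdis _ _ _ euw vu vw.
  have Xd p p' : p \in st u w :: L u w -> p' \in pos v :: C v -> absc tau p != absc tau p'.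
    move=> hp hp'; apply: Xn; [exact: SL hp | exact: SC hp' |].
    by apply: (polydisj_neq (L0 _ _ euw) (C0 v) dis).
  have := polydisj_even dis Xd.
  rewrite (@up_far _ tau _ _ (last (pos v) (C v)) (al v) (be v)); first last.
  - by move=> p hp; apply: Xd => //; rewrite mem_last.
  - by move=> p hp; apply: far hp.
  rewrite -/(q v) -/(sgn v) /pot /x.
  have [[-> ->]|[-> ->]] := Lend _ _ euw;
  by case: (up _ _ _ _); case: (dn _ _ _ _); case: (dn _ _ _ _); case: (sgn v && _);
     case: (sgn v && _).
have dnE u w v : e u w -> v != u -> v != w ->
    dn tau (st u w) (L u w) (pos v) = pot v u (+) pot v w (+) ((x u < x v) (+) (x w < x v)).
  move=> euw vu vw.
  have dis := Cdis _ _ _ euw vu vw.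
  have := @up_addb_dn _ tau (st u w) (L u w) (pos v).
  rewrite upE // /x => h.
  have {h} : pot v u (+) pot v w (+) dn tau (st u w) (L u w) (pos v) =
     (x u < x v) (+) (x w < x v).
    rewrite {}h /x; first by have [[-> ->]|[-> ->]] := Lend _ _ euw; rewrite // addbC.
    - move=> p hp; apply: Xn; [exact: SL hp | exact: Spos |].
      by apply: (polydisj_neq (L0 _ _ euw) (C0 v) dis) => //; rewrite mem_head.
    - move=> z hz s s01; case: (C v) (C0 v) dis => // c m _ dis.
      by rewrite -(segpt0 (pos v) c); apply: (dis _ (pos v, c)); rewrite /= ?mem_head ?lexx ?ler01.
  rewrite -/(x u) -/(x w) -/(x v).
  by case: (dn _ _ _ _); case: (_ < _); case: (_ < _); case: (pot v u); case: (pot v w).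
(* The [pot] terms are symmetric in [u] and [w]; the comparison of abscissas makes this a
   tournament. *)
exists (fun u w => pot w u (+) pot u w (+) (x w < x u)); split=> [u v uv|].
  have : x u != x v by apply: Xn => // /posI /eqP; rewrite (negbTE uv).
  by case: ltgtP => //= _ _; case: (pot u v); case: (pot v u).
move=> a b c d eab ecd ac ad bc bd.
have dis := Ldis _ _ _ _ eab ecd ac ad bc bd.
have := polydisj_even dis; move=> /(_ tau).
have Xd p p' : p \in st a b :: L a b -> p' \in st c d :: L c d -> absc tau p != absc tau p'.
  move=> hp hp'; apply: Xn; [exact: SL hp | exact: SL hp' |].
  by apply: (polydisj_neq (L0 _ _ eab) (L0 _ _ ecd) dis).
move=> /(_ Xd).
have -> : up tau (st a b) (L a b) (st c d) (+)
          up tau (st a b) (L a b) (last (st c d) (L c d)) =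
          pot c a (+) pot c b (+) (pot d a (+) pot d b).
  have [[-> ->]|[-> ->]] := Lend _ _ ecd; rewrite !upE // 1?eq_sym //.
  by rewrite addbC.
have -> : dn tau (st c d) (L c d) (st a b) (+)
          dn tau (st c d) (L c d) (last (st a b) (L a b)) =
          (pot a c (+) pot a d (+) ((x c < x a) (+) (x d < x a))) (+)
          (pot b c (+) pot b d (+) ((x c < x b) (+) (x d < x b))).
  have [[-> ->]|[-> ->]] := Lend _ _ eab; rewrite !dnE // 1?eq_sym //.
  by rewrite addbC.
(* Both sides are sums of the same twelve bits. *)
move=> h; rewrite -[RHS]h [LHS](AC ((3*3)*(3*3))
  (((1*7)*(4*10))*(((2*5)*(3*6))*((8*11)*(9*12))))) //.
Qed.

(** * From outerplanar drawings to even tournaments *)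

Section Plane.
Variable R : realType.
Local Notation point := (R * R)%type.

Lemma compact_bigcup_fin (T : topologicalType) (I : finType) (F : I -> set T) :
  (forall i, compact (F i)) -> compact (\bigcup_i F i).
Proof.
move=> cF; apply/compact_near_coveringP => J G P GF cov.
have : \forall j \near G, forall i, F i `<=` P j.
  apply: filter_forall => i.
  by apply: (iffLR (compact_near_coveringP _) (cF i)) => x Fx; apply: cov; exists i.
by apply: filterS => j h x [i _ Fx]; apply: h Fx.
Qed.

(** The differences [a - b] form a compact set without 0, so a ball around 0 misses it. *)
Lemma compact_separation (A B : set point) : compact A -> compact B ->
  (forall p, A p -> ~ B p) ->
  exists2 eps : R, 0 < eps & forall a b, A a -> B b -> eps <= `|a - b|.
Proof.
move=> cA cB dis.
pose f (z : point * point) : point := z.1 - z.2.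
have fc : continuous f by move=> z; apply: cvgB; [exact: cvg_fst | exact: cvg_snd].
have cK : compact (f @` (A `*` B)).
  apply: continuous_compact; last exact: compact_setX.
  exact: continuous_subspaceT.
have clK := compact_closed (@norm_hausdorff _ _) cK.
have /nbhs_normP[eps eps0 he] : nbhs (0 : point) (~` (f @` (A `*` B))).
  apply: open_nbhs_nbhs; split; first exact: closed_openC.
  move=> [[a b] [Aa Bb]] /eqP; rewrite /f /= subr_eq0 => /eqP eab.
  by apply: (dis a Aa); rewrite eab.
exists eps => // a b Aa Bb; rewrite leNgt; apply/negP => lt.
apply: (he (a - b)); first by rewrite /ball_ /= sub0r normrN.
by exists (a, b).
Qed.

Lemma unif_continuous_arc (g : R -> point) (delta : R) :
  {within `[0, 1], continuous g} -> 0 < delta ->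
  exists2 eta : R, 0 < eta & forall s t, 0 <= s <= 1 -> 0 <= t <= 1 ->
    `|s - t| < eta -> `|g s - g t| < delta.
Proof.
move=> /subspace_continuousP gc d0.
have := iffLR (compact_near_coveringP _) (@segment_compact R 0 1).
move=> /(_ R 0^'+ (fun eta s => 0 <= s <= 1 -> forall t, 0 <= t <= 1 ->
   `|s - t| < eta -> `|g s - g t| < delta)) cov.
have : \forall eta \near 0^'+, `[0, 1] `<=` (fun s : R => 0 <= s <= 1 -> forall t, 0 <= t <= 1 ->
   `|s - t| < eta -> `|g s - g t| < delta).
  apply: cov => x x01.
  have /cvgrPdist_lt /(_ (delta / 2)) := gc x x01.
  have d20 : 0 < delta / 2 by lra.
  move=> /(_ d20) /nbhs_normP[r r0 hr].
  have r20 : 0 < r / 2 by move: r0 => /=; lra.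
  exists (ball x (r / 2), [set eta | eta < r / 2]) => /=.
    by split; [exact: nbhsx_ballx | exact: nbhs_right_lt].
  case=> s eta /= [xs ltr] s01 t t01 st.
  have hs : `|g x - g s| < delta / 2.
    by apply: hr => //=; move: xs; rewrite -ball_normE /ball_ /=; lra.
  have ht : `|g x - g t| < delta / 2.
    apply: hr => //=; move: xs; rewrite -ball_normE /ball_ /= => xs.
    have := ler_distD s x t; lra.
  have := ler_distD (g x) (g s) (g t); rewrite [`|g s - g x|]distrC; lra.
move=> h; have [eta [eta0 heta]] : exists eta : R, 0 < eta /\
    `[0, 1] `<=` (fun s : R => 0 <= s <= 1 -> forall t, 0 <= t <= 1 -> `|s - t| < eta -> `|g s - g t| < delta).
  apply: (@filter_ex _ (0^'+ : set_system R)).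
  by apply: filterI => //; exact: nbhs_right_gt.
by exists eta => // s t s01; apply: heta => //=; rewrite in_itv.
Qed.

(** The first vertex [g 0] is left out because [segs], [trace] and [polydisj] take the start of a
    line separately. *)
Definition polygon (g : R -> point) (N : nat) : seq point :=
  [seq g (k.+1%:R / N%:R) | k <- iota 0 N].

Lemma segs_polygon (g : R -> point) N z : z \in segs (g 0) (polygon g N) ->
  exists2 k, (k < N)%N & z = (g (k%:R / N%:R), g (k.+1%:R / N%:R)).
Proof.
have gen m n : z \in segs (g (m%:R / N%:R)) [seq g (k.+1%:R / N%:R) | k <- iota m n] ->
    exists2 k, (k < m + n)%N & z = (g (k%:R / N%:R), g (k.+1%:R / N%:R)).
  elim: n m => [|n IH] m //=; rewrite inE => /orP[/eqP->|/IH[k]].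
    by exists m => //; rewrite addnS ltnS leq_addr.
  by rewrite addSnnS => ? ?; exists k.
rewrite -[in segs (g 0)](mul0r N%:R^-1) -[0](mulr0n 1).
by move=> /gen[k]; rewrite add0n => ? ?; exists k.
Qed.

Lemma last_polygon (g : R -> point) N : (0 < N)%N ->
  last (g 0) (polygon g N) = g 1.
Proof.
case: N => // N _; rewrite /polygon -[in iota 0 _]addn1 iotaD map_cat last_cat /=.
by rewrite add0n divff // pnatr_eq0.
Qed.

Lemma polygon_unit k N : (k < N)%N ->
  0 <= (k%:R / N%:R : R) <= 1 /\ 0 <= (k.+1%:R / N%:R : R) <= 1.
Proof.
move=> kN; have N0 : 0 < (N%:R : R) by rewrite ltr0n; case: N kN.
by split; rewrite divr_ge0 ?ler0n //= ler_pdivrMr // mul1r ler_nat // ltnW.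
Qed.

Lemma polygon_mem (g : R -> point) N p : p \in g 0 :: polygon g N ->
  exists2 s, 0 <= s <= 1 & p = g s.
Proof.
rewrite inE => /orP[/eqP->|/mapP[k]]; first by exists 0; rewrite ?lexx ?ler01.
rewrite mem_iota add0n => /= kN ->; exists (k.+1%:R / N%:R) => //.
by case: (polygon_unit kN).
Qed.

Lemma norm_segpt (s : R) (a b : point) : 0 <= s <= 1 ->
  `|a - segpt s a b| <= `|a - b|.
Proof.
move=> /andP[s0 s1].
have -> : a - segpt s a b = s *: (a - b).
  case: a => a1 a2; case: b => b1 b2.
  by congr pair; rewrite /segpt /= /GRing.scale /=; ring.
by rewrite normrZ ger0_norm // ler_piMl.
Qed.

(** A point of a segment is no farther from its first end than the second end is, so uniform
    continuity applied to consecutive parameters suffices. *)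
Lemma polygon_close (g : R -> point) (delta : R) :
  {within `[0, 1], continuous g} -> 0 < delta ->
  \forall N \near \oo, forall z s, z \in segs (g 0) (polygon g N) ->
    0 <= s <= 1 -> exists2 r, 0 <= r <= 1 & `|g r - segpt s z.1 z.2| < delta.
Proof.
move=> gc d0; have [eta eta0 h] := unif_continuous_arc gc d0.
have : \forall N \near \oo, eta^-1 < N%:R.
  exact: nbhs_infty_gtr.
apply: filterS => N hN z s /segs_polygon[k kN ->] s01 /=.
have [k1 k2] := polygon_unit kN.
exists (k%:R / N%:R) => //; apply: le_lt_trans (norm_segpt _ _ s01) _.
have N0 : 0 < (N%:R : R) by rewrite ltr0n; case: N kN {hN k1 k2}.
apply: h => //; rewrite -mulrBl -natr1 opprD addrA subrr add0r mulN1r normrN.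
by rewrite ger0_norm ?invr_ge0 ?ltW // invf_plt.
Qed.

Definition trace (a : point) l : set point :=
  [set p | exists z s, [/\ z \in segs a l, 0 <= s <= 1 & p = segpt s z.1 z.2]].

Lemma segpt_continuous (a b : point) : continuous (fun s : R => segpt s a b).
Proof.
move=> s.
have lin (x y : R) : (1 - t) * x + t * y @[t --> s] --> (1 - s) * x + s * y.
  apply: cvgD; apply: cvgM; try exact: cvg_cst; try exact: cvg_id.
  by apply: cvgB; [exact: cvg_cst | exact: cvg_id].
exact: cvg_pair (lin a.1 b.1) (lin a.2 b.2).
Qed.

Lemma trace_cons a b l : trace a (b :: l) =
  (fun s => segpt s a b) @` `[0, 1] `|` trace b l.
Proof.
apply/seteqP; split=> p.
  case=> z [s [/= + s01 ->]]; rewrite inE => /orP[/eqP->|zl]; last by right; exists z, s.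
  by left; exists s => //=; rewrite in_itv.
case=> [[s /= + <-]|[z [s [zl s01 ->]]]].
  by rewrite in_itv /= => s01; exists (a, b), s; rewrite /= mem_head.
by exists z, s; rewrite /= inE zl orbT.
Qed.

Lemma trace_compact a l : compact (trace a l).
Proof.
elim: l a => [|b l IH] a.
  have -> : trace a [::] = set0 by apply/seteqP; split=> p //= [z [s []]].
  exact: compact0.
rewrite trace_cons; apply: compactU => //; apply: continuous_compact.
  exact/continuous_subspaceT/segpt_continuous.
exact: segment_compact.
Qed.

Lemma ball_convex (c : point) (r : R) a b s : 0 <= s <= 1 ->
  `|c - a| < r -> `|c - b| < r -> `|c - segpt s a b| < r.
Proof.
move=> /andP[s0 s1] ca cb.
have -> : c - segpt s a b = (1 - s) *: (c - a) + s *: (c - b).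
  case: a {ca} => a1 a2; case: b {cb} => b1 b2; case: c => c1 c2.
  by congr pair; rewrite /segpt /= /GRing.scale /=; ring.
apply: le_lt_trans (ler_normD _ _) _; rewrite !normrZ !ger0_norm //; last lra.
case: (ltrP 0 s) => sp; last by have -> : s = 0; [lra|]; lra.
by nra.
Qed.

(* The points joined to [p] by a polygonal line inside an open set [U] form a
   relatively clopen subset of [U]. *)
Lemma polygonally_connected (U : set point) p x : open U ->
  connected_component U p x ->
  exists l, [/\ last p l = x, trace p l `<=` U & U x].
Proof.
move=> oU [S [Sp SU conS] Sx].
pose A := [set y | exists l, [/\ last p l = y, trace p l `<=` U & U y]].
have Ap : A p.
  exists [::]; split=> //; last exact: SU.
  by move=> q [z [s []]].
have ballU y : U y -> exists2 r : R, 0 < r & forall q, `|y - q| < r -> U q.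
  move=> Uy; have /nbhs_normP[r r0 hr] : nbhs y U by apply: open_nbhs_nbhs; split.
  by exists r.
have step y q l (r : R) : (forall q, `|y - q| < r -> U q) -> forall y', `|y - y'| < r ->
    `|y - q| < r -> last p l = y' -> trace p l `<=` U ->
    exists l', [/\ last p l' = q, trace p l' `<=` U & U q].
  move=> hr y' yy' yq ly' tl; exists (rcons l q); split; [by rewrite last_rcons| |exact: hr].
  move=> w [z [s [zl s01 ->]]].
  have : z \in rcons (segs p l) (last p l, q).
    have -> // : rcons (segs p l) (last p l, q) = segs p (rcons l q).
    by elim: (l) (p) => //= b l' IH p'; rewrite IH.
  rewrite mem_rcons inE => /orP[/eqP->|zl'] /=; last by apply: tl; exists z, s.
  by apply/hr/ball_convex => //; rewrite ly'.
have oA : open A.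
  rewrite openE => y [l [ly tl Uy]]; have [r r0 hr] := ballU y Uy.
  apply: (iffRL (nbhs_normP y A)); exists r => // q /= yq.
  by apply: (step y q l r hr y) => //; rewrite subrr normr0.
have oB : open (U `\` A).
  rewrite openE => y [Uy nAy]; have [r r0 hr] := ballU y Uy.
  apply: (iffRL (nbhs_normP y (U `\` A))); exists r => // q /= yq; split; first exact: hr.
  move=> [l [lq tl Uq]]; apply: nAy.
  by apply: (step y y l r hr q) => //; rewrite subrr normr0.
have SAS : S `&` A = S.
  apply: conS; [by exists p | by exists A |].
  exists (~` (U `\` A)); first exact: open_closedC.
  apply/seteqP; split=> y [Sy].
    by move=> Ay; split=> // -[].
  by move=> h; split=> //; apply: contrapT => nAy; apply: h; split=> //; exact: SU.
by move: Sx; rewrite -SAS => -[_ [l ?]]; exists l.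
Qed.

Lemma unbounded_far (C : set point) (M : R) : ~ bounded_set C ->
  exists2 x, C x & M < `|x|.
Proof.
move=> nb; apply: contrapT => h; apply: nb.
exists M; split; first exact: num_real.
move=> M' MM' x Cx; apply: (@le_trans _ _ M); last exact: ltW.
by rewrite leNgt; apply/negP => ?; apply: h; exists x.
Qed.

(** The norm is the maximum norm: some coordinate of [q] exceeds [M] in absolute value, and that
    coordinate with its sign is the functional. *)
Lemma far_functional (M : R) (q : point) : M < `|q| -> exists al be : R,
  forall p : point, `|p| <= M -> al * p.1 + be * p.2 < al * q.1 + be * q.2.
Proof.
have n1 (p : point) : `|p.1| <= `|p| by rewrite prod_normE le_max lexx.
have n2 (p : point) : `|p.2| <= `|p| by rewrite prod_normE le_max lexx orbT.
rewrite prod_normE lt_max => /orP[] h.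
- case: (lerP 0 q.1) h => [q0|q0].
    rewrite ger0_norm // => h; exists 1, 0 => p pM; have := le_trans (n1 p) pM.
    by rewrite ler_norml => /andP[? ?]; lra.
  rewrite ltr0_norm // => h; exists (-1), 0 => p pM; have := le_trans (n1 p) pM.
  by rewrite ler_norml => /andP[? ?]; lra.
- case: (lerP 0 q.2) h => [q0|q0].
    rewrite ger0_norm // => h; exists 0, 1 => p pM; have := le_trans (n2 p) pM.
    by rewrite ler_norml => /andP[? ?]; lra.
  rewrite ltr0_norm // => h; exists 0, (-1) => p pM; have := le_trans (n2 p) pM.
  by rewrite ler_norml => /andP[? ?]; lra.
Qed.

End Plane.

Lemma mem_edges (G : sgraph) (u v : G) : adj u v -> [set u; v]%SET \in edges G.
Proof. by move=> uv; apply/imsetP; exists (u, v); rewrite ?inE. Qed.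

(** * Arcs of the drawing and lines escaping through the outer face *)

Section Drawing.
Variables (R : realType) (G : sgraph).
Variables (pos : G -> R * R) (arc : {set G} -> R -> R * R).
Hypothesis emb : plane_embedding pos arc.

Definition arc_image (e : {set G}) := arc e @` `[0, 1].

Lemma pos_injective : injective pos.
Proof. by case: emb. Qed.

Lemma arc_continuous e : e \in edges G -> {within `[0, 1], continuous (arc e)}.
Proof. by case: emb => _ h _ _ _ /h[]. Qed.

Lemma arc_image_compact e : e \in edges G -> compact (arc_image e).
Proof.
move=> he; apply: continuous_compact; last exact: segment_compact.
exact: arc_continuous.
Qed.

Lemma arc_imageP e p : e \in edges G -> arc_image e p ->
  (exists2 u, u \in e & p = pos u) \/ (exists2 t, t \in `]0, 1[ & p = arc e t).
Proof.
move=> he [t /= t01 <-]; case: emb => _ _ ends _ _.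
have endE t' : [set arc e 0; arc e 1] (arc e t') -> exists2 u, u \in e & arc e t' = pos u.
  by rewrite (ends e he) => -[u /= ue <-]; exists u.
have [->|t0] := eqVneq t 0; first by left; apply: endE; left.
have [->|t1] := eqVneq t 1; first by left; apply: endE; right.
right; exists t => //; move: t01; rewrite !in_itv /= => /andP[h0 h1].
by rewrite !lt_neqAle h0 h1 eq_sym t0 t1.
Qed.

Lemma arc_image_pos e v : e \in edges G -> v \notin e -> ~ arc_image e (pos v).
Proof.
move=> he ve /(arc_imageP he)[[u ue /pos_injective vu]|[t t01 h]].
  by rewrite vu ue in ve.
by case: emb => _ _ _ h4 _; apply: (h4 e he v t).
Qed.

Lemma arc_image_disjoint e f p : e \in edges G -> f \in edges G ->
  (forall u, u \in e -> u \notin f) -> arc_image e p -> ~ arc_image f p.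
Proof.
move=> he hf dis ep fp; have ef : e <> f.
  move=> ef; case: (imsetP he) => -[u v] _ eE; move: (dis u).
  by rewrite -ef eE /= !inE eqxx => /(_ isT).
case: (arc_imageP he ep) => [[u ue pu]|[s s01 ps]].
  by apply: (arc_image_pos hf (dis u ue)); rewrite -pu.
case: (arc_imageP hf fp) => [[u uf pu]|[t t01 pt]].
  apply: (@arc_image_pos e u he); last by rewrite -pu.
  by apply/negP => /dis; rewrite uf.
by case: emb => _ _ _ _ h5; apply: (h5 e f he hf ef s t) => //; rewrite -ps -pt.
Qed.

Lemma drawing_compact : compact (drawing pos arc).
Proof.
apply: compactU.
  have -> : range pos = \bigcup_v [set pos v].
    by apply/seteqP; split=> p [v _ h]; exists v => //; rewrite h.
  by apply: compact_bigcup_fin => v; exact: compact_set1.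
have -> : \bigcup_(e in [set e | e \in edges G]) (arc e @` `[0, 1]) =
    \bigcup_e (if e \in edges G then arc_image e else set0).
  apply/seteqP; split=> p [e].
    by move=> /= he h; exists e => //; rewrite he.
  by move=> _; case: ifP => // he h; exists e.
apply: compact_bigcup_fin => e; case: ifP => [|_]; last exact: compact0.
exact: arc_image_compact.
Qed.

Lemma drawing_arc_image e : e \in edges G -> arc_image e `<=` drawing pos arc.
Proof. by move=> he p h; right; exists e. Qed.

(* [C.1] continues [pos v] to a polygonal line; that the linear functional with
   coefficients [C.2] is larger at its end than on the drawing is all that is
   needed of a point at infinity. *)
Lemma escape (v : G) : closure (outer_face (drawing pos arc)) (pos v) ->
  exists C : seq (R * R) * (R * R), [/\ C.1 != [::],
    forall e, e \in edges G -> v \notin e ->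
      forall p, trace (pos v) C.1 p -> ~ arc_image e p &
    forall p, drawing pos arc p -> C.2.1 * p.1 + C.2.2 * p.2 <
      C.2.1 * (last (pos v) C.1).1 + C.2.2 * (last (pos v) C.1).2].
Proof.
move=> clv.
pose B := \bigcup_e (if (e \in edges G) && (v \notin e) then arc_image e else set0).
have cB : compact B.
  apply: compact_bigcup_fin => e; case: ifP => [/andP[he _]|_]; last exact: compact0.
  exact: arc_image_compact.
(* Arcs that do not end at [v] keep a distance [eps] from it, so the segment to a point [p] of the
   outer face within [eps] of [v] can only meet arcs at [v]. *)
have [|eps eps0 sep] := compact_separation (@compact_set1 _ (pos v)) cB.
  move=> p -> [e _]; case: ifP => // /andP[he ve]; exact: arc_image_pos.
have [p [[Dp unb] /= vp]] := clv _ (nbhsx_ballx (pos v) eps eps0).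
have {}vp : `|pos v - p| < eps by move: vp; rewrite -ball_normE.
have [M [_ hM]] := compact_bounded drawing_compact.
(* [M] itself need not bound the drawing, but every larger number does. *)
have [x px Mx] := unbounded_far (M + 1) unb.
have [|l [lx tl Ux]] := polygonally_connected _ px.
  exact/closed_openC/(compact_closed (@norm_hausdorff _ _))/drawing_compact.
have [al [be far]] := far_functional Mx.
exists (p :: l, (al, be)); split=> //= [e he ve w|q Dq].
  rewrite trace_cons => -[[s /= s01 <-]|/tl nD] ew; last first.
    by apply: nD; apply: (drawing_arc_image he).
  have := sep (pos v) _ erefl (_ : B (segpt s (pos v) p)).
  rewrite leNgt => /(_ _)/negP; apply; first by exists e => //; rewrite he ve.
  by apply: le_lt_trans vp; apply: norm_segpt; move: s01; rewrite in_itv.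
by rewrite lx; apply: far; apply: hM Dq; lra.
Qed.

Lemma polygon_polydisj (e : {set G}) a l : e \in edges G ->
  (forall p, trace a l p -> ~ arc_image e p) ->
  \forall N \near \oo, polydisj (arc e 0) (polygon (arc e) N) a l.
Proof.
move=> he dis.
have [|eps eps0 sep] := compact_separation (@trace_compact R a l) (arc_image_compact he).
  exact: dis.
have := polygon_close (arc_continuous he) eps0; apply: filterS => N close.
move=> z z' hz hz' s t s01 t01 est.
have [r r01] := close z s hz s01; apply/negP; rewrite -leNgt est distrC.
by apply: sep; [exists z', t | exists r => //=; rewrite in_itv].
Qed.

Lemma polygons_polydisj (e f : {set G}) : e \in edges G -> f \in edges G ->
  (forall u, u \in e -> u \notin f) ->
  \forall N \near \oo,
    polydisj (arc e 0) (polygon (arc e) N) (arc f 0) (polygon (arc f) N).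
Proof.
move=> he hf dis.
have [|eps eps0 sep] := compact_separation (arc_image_compact he) (arc_image_compact hf).
  by move=> p; exact: arc_image_disjoint.
have eps20 : 0 < eps / 2 by lra.
have := polygon_close (arc_continuous hf) eps20.
have := polygon_close (arc_continuous he) eps20; apply: filterS2 => N closee closef.
move=> z z' hz hz' s t s01 t01 est.
have [r r01 hr] := closee z s hz s01; have [r' r'01 hr'] := closef z' t hz' t01.
have : eps <= `|arc e r - arc f r'|.
  by apply: sep; [exists r | exists r'] => //=; rewrite in_itv.
have := ler_distD (segpt s z.1 z.2) (arc e r) (arc f r').
by rewrite {2}est [`|segpt _ _ _ - arc f r'|]distrC; lra.
Qed.

Lemma arc_ends (u v : G) : adj u v ->
  arc [set u; v]%SET 0 = pos u /\ arc [set u; v]%SET 1 = pos v \/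
  arc [set u; v]%SET 0 = pos v /\ arc [set u; v]%SET 1 = pos u.
Proof.
move=> uv; set e := [set u; v]%SET; have he : e \in edges G by exact: mem_edges.
case: emb => _ _ /(_ e he) ends _ _.
have nuv : pos u <> pos v.
  by move=> /pos_injective uv'; rewrite uv' (adj_irr v) in uv.
have : [set arc e 0; arc e 1] (pos u) by rewrite ends; exists u => //=; rewrite !inE eqxx.
have : [set arc e 0; arc e 1] (pos v) by rewrite ends; exists v => //=; rewrite !inE eqxx orbT.
by move=> [] /= hv [] /= hu; [case: nuv; rewrite hu hv | right | left | case: nuv; rewrite hu hv].
Qed.

End Drawing.

Theorem outerplanar_even_tournament (R : realType) (G : sgraph) :
  outerplanar G R -> exists t, even_tournament (@adj G) t.
Proof.
move=> [pos [arc [emb outer]]].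
have [C hC] := choice (fun v => escape emb (outer v)).
(* One [N] has to serve all pairs of disjoint edges and all pairs of an edge and a vertex off it;
   there are finitely many. *)
have near1 : \forall N \near \oo, forall ef : {set G} * {set G},
    ef.1 \in edges G -> ef.2 \in edges G -> (forall u, u \in ef.1 -> u \notin ef.2) ->
    polydisj (arc ef.1 0) (polygon (arc ef.1) N) (arc ef.2 0) (polygon (arc ef.2) N).
  apply: filter_forall => -[e f] /=.
  have [he|he] := boolP (e \in edges G); last by near=> N.
  have [hf|hf] := boolP (f \in edges G); last by near=> N.
  have [dis|ndis] := pselect (forall u, u \in e -> u \notin f); last by near=> N.
  by have := polygons_polydisj emb he hf dis; apply: filterS.
have near2 : \forall N \near \oo, forall ev : {set G} * G,
    ev.1 \in edges G -> ev.2 \notin ev.1 ->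
    polydisj (arc ev.1 0) (polygon (arc ev.1) N) (pos ev.2) (C ev.2).1.
  apply: filter_forall => -[e v] /=.
  have [he|he] := boolP (e \in edges G); last by near=> N.
  have [ve|ve] := boolP (v \notin e); last by near=> N.
  have [_ h _] := hC v.
  by have := polygon_polydisj emb he (h e he ve); apply: filterS.
have [N [[dis1 dis2] N0]] : exists N : nat, ((forall ef : {set G} * {set G},
    ef.1 \in edges G -> ef.2 \in edges G -> (forall u, u \in ef.1 -> u \notin ef.2) ->
    polydisj (arc ef.1 0) (polygon (arc ef.1) N) (arc ef.2 0) (polygon (arc ef.2) N)) /\
    (forall ev : {set G} * G, ev.1 \in edges G -> ev.2 \notin ev.1 ->
    polydisj (arc ev.1 0) (polygon (arc ev.1) N) (pos ev.2) (C ev.2).1)) /\ (0 < N)%N.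
  apply: (@filter_ex _ \oo).
  by apply: filterI; [exact: filterI | exact: nbhs_infty_gt].
apply: (@polygonal_even_tournament _ _ _ pos
  (fun u v => arc [set u; v]%SET 0) (fun u v => polygon (arc [set u; v]%SET) N)
  (fun v => (C v).1) (fun v => (C v).2.1) (fun v => (C v).2.2)).
- exact: (pos_injective emb).
- by move=> u v _; rewrite -size_eq0 size_map size_iota -lt0n.
- by move=> u v uv; rewrite last_polygon //; exact: arc_ends.
- by move=> v; case: (hC v).
- move=> u v w z uv wz uw uz vw vz; apply: (dis1 (_, _)) => /=; try exact: mem_edges.
  by move=> x; rewrite !inE => /orP[] /eqP->; rewrite negb_or ?uw ?uz ?vw ?vz.
- move=> u w v uw vu vw; apply: (dis2 (_, _)) => /=; first exact: mem_edges.
  by rewrite !inE negb_or vu vw.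
- move=> v u w p uw /polygon_mem[s s01 ->]; have [_ _ far] := hC v.
  apply: far; apply: (@drawing_arc_image R G pos arc _ (mem_edges uw)).
  by exists s => //=; rewrite in_itv.
Unshelve. all: by end_near.
Qed.

Local Close Scope classical_set_scope.
Local Open Scope nat_scope.

(** * From arc colourings back to incidences *)

Lemma set2_inj_r (T : finType) (v w w' : T) : v != w ->
  [set v; w]%SET = [set v; w']%SET -> w = w'.
Proof.
move=> vw /setP/(_ w); rewrite !inE eqxx orbT eq_sym (negbTE vw) => /esym/eqP //.
Qed.

(** Arcs leaving [u] correspond to its strong incidences and arcs entering [u] to its weak ones. An
    incidence stores its edge as a set, so the head of the arc is recovered as the other element. *)
Lemma colorable_incidence (G : sgraph) (D : nat) : colorable D (@adj G) ->
  exists phi : incidence G -> 'I_D, conditional_incidence_coloring phi.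
Proof.
move=> [C [pC sC satC]].
have neq (u v : G) : adj u v -> u != v.
  by apply: contraTneq => ->; rewrite adj_irr.
have exk (i : incidence G) : exists k, exists w, [/\ adj (val i).1 w,
    (val i).2 = [set (val i).1; w]%SET & C (val i).1 w k].
  case: i => -[v f] /= /andP[/imsetP[[a b]]]; rewrite inE /= => ab -> vab.
  suff [w vw ->] : exists2 w, adj v w & [set a; b]%SET = [set v; w]%SET.
    have /existsP[k hk] : [exists k, C v w k] by rewrite -sC.
    by exists k, w.
  move: vab; rewrite !inE => /orP[] /eqP->; first by exists b.
  by exists a; [rewrite adj_sym | rewrite finset.setUC].
have [phi hphi] := choice exk; exists phi.
have phiE (u v : G) i : val i = (u, [set u; v]%SET) -> adj u v -> C u v (phi i).
  move=> vi uv; have [w []] := hphi i; rewrite vi /= => uw fE.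
  by rewrite (set2_inj_r (neq _ _ uv) fE).
have weakE (u : G) i : i \in weak u -> exists2 v, C v u (phi i) &
    val i = (v, [set u; v]%SET).
  rewrite inE => /existsP[v /andP[uv /eqP vi]]; exists v => //.
  by apply: phiE; [rewrite finset.setUC | rewrite adj_sym].
have strongE (u : G) i : i \in strong u -> exists2 v, C u v (phi i) &
    val i = (u, [set u; v]%SET).
  by rewrite inE => /existsP[v /andP[uv /eqP vi]]; exists v => //; apply: phiE.
have [p1 _ p3 p4 p5] := pC.
have sup (u v : G) k : C u v k -> adj u v.
  by move=> h; rewrite sC; apply/existsP; exists k.
have inc (u v : G) : adj u v -> exists i : incidence G, val i = (u, [set u; v]%SET).
  move=> uv; have h : ([set u; v]%SET \in edges G) && (u \in [set u; v]%SET).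
    by rewrite mem_edges // !inE eqxx.
  by exists (exist _ (u, [set u; v]%SET) h).
split.
- move=> u v i j uv vi vj phij.
  have h1 := phiE u v i vi uv.
  have h2 : C v u (phi j) by apply: phiE; [rewrite finset.setUC | rewrite adj_sym].
  by have := p3 _ _ _ h1; rewrite phij h2.
- move=> u c; apply/card_le1_eqP => i j.
  rewrite [i \in _]inE [j \in _]inE => /andP[iw /eqP ic] /andP[jw /eqP jc].
  have [v hv vi] := weakE u i iw; have [w hw vj] := weakE u j jw.
  by apply: val_inj; rewrite vi vj; rewrite ic in hv; rewrite jc in hw; rewrite (p5 _ _ _ _ hv hw).
- move=> u c; apply/card_le1_eqP => i j.
  rewrite [i \in _]inE [j \in _]inE => /andP[iw /eqP ic] /andP[jw /eqP jc].
  have [v hv vi] := strongE u i iw; have [w hw vj] := strongE u j jw.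
  by apply: val_inj; rewrite vi vj; rewrite ic in hv; rewrite jc in hw; rewrite (p4 _ _ _ _ hv hw).
- move=> u du c.
  (* Degree at least [D - 1] leaves at most one free outgoing colour, so saturation applies. *)
  have sat : (free_out C u :&: free_in C u)%SET = finset.set0.
    by apply: satC; rewrite (card_free_out u pC sC) leq_subLR addnC -leq_subLR.
  have : (c \notin free_out C u) || (c \notin free_in C u).
    by rewrite -negb_and -finset.in_setI sat inE.
  rewrite !inE => /orP[] /forallPn[v]; rewrite negbK => h.
    have [i vi] := inc u v (sup _ _ _ h); exists i.
      by rewrite !inE; apply/orP; right; apply/existsP; exists v; rewrite (sup _ _ _ h) vi eqxx.
    by apply: (p1 u v) => //; apply: phiE => //; exact: sup h.
  have vu := sup _ _ _ h.
  have [i vi] := inc v u vu; exists i.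
    rewrite !inE; apply/orP; left; apply/existsP; exists v.
    by rewrite adj_sym vu vi finset.setUC eqxx.
  by apply: (p1 v u) => //; apply: phiE.
Qed.

Theorem theorem6 (R : realType) (Delta : nat) (hDelta : (4 <= Delta)%N)
    (G : sgraph) (hG : outerplanar G R) (hdeg : (max_degree G <= Delta)%N) :
  exists phi : incidence G -> 'I_Delta, conditional_incidence_coloring phi.
Proof.
have [t ev] := outerplanar_even_tournament hG.
apply: colorable_incidence.
apply: even_tournament_colorable hDelta (@adj_sym G) (@adj_irr G) ev _ => u.
by apply: leq_trans hdeg; exact: (leq_bigmax u).
Qed.
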